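(* Let $p\ge1$, $m=2p$, let $\{\beta(k)\}_{k\ge0}$ be $p\times m$ matrices with $\beta(k)J\beta(k)^*=I_p$, put $C_k=2K^*\beta(k)^*\beta(k)K-j$, and consider the system $W_{k+1}(\lambda)-W_k(\lambda)=-\frac{i}{\lambda}jC_kW_k(\lambda)$ on the semiaxis $k\ge0$. Then there is exactly one function $\varphi_\infty$ belonging to all the sets $\mathcal N(N)$, $N\ge0$: $\bigcap_{N=0}^\infty\mathcal N(N)=\{\varphi_\infty\}$.
   Context: $\mathbb C_-$ is the open lower half-plane; $j=\mathrm{diag}(I_p,-I_p)$, $J=\begin{bmatrix}0&I_p\\ I_p&0\end{bmatrix}$, $K=\frac1{\sqrt2}\begin{bmatrix}I_p&-I_p\\ I_p&I_p\end{bmatrix}$. $W_k$ is the solution with $W_0=I_m$. For $N\ge0$ let $\mathcal W(N,\lambda)=\{\mathcal W_{ij}(N,\lambda)\}_{i,j=1}^2=KW_{N+1}(\bar\lambda)^*$ ($p\times p$ blocks), and let $\mathcal N(N)$ (the Weyl disc) be the set of $p\times p$ matrix functions $\varphi$ holomorphic in $\mathbb C_-$ of the form $\varphi=i(\mathcal W_{21}(N,\cdot)R+\mathcal W_{22}(N,\cdot)Q)(\mathcal W_{11}(N,\cdot)R+\mathcal W_{12}(N,\cdot)Q)^{-1}$, where $R,Q$ are $p\times p$ matrix functions meromorphic in $\mathbb C_-$, well defined at $\lambda=-i$, with $R^*R+Q^*Q>0$ and $R^*R\le Q^*Q$. *)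

(* Defs.v *)
From mathcomp Require Import all_boot all_order all_algebra.
From mathcomp Require Import complex reals.
Set Implicit Arguments.
Unset Strict Implicit.
Unset Printing Implicit Defensive.
Import Order.TTheory GRing.Theory Num.Theory.
Local Open Scope ring_scope.
Local Open Scope complex_scope.

Section Defs.
Variable R : realType.
Local Notation C := R[i].

Definition adjmx (a b : nat) (A : 'M[C]_(a, b)) : 'M[C]_(b, a) :=
  (map_mx Num.conj A)^T.

Definition lowerHP (z : C) : Prop := 'Im z < 0.

Definition holo_at (a b : nat) (f : C -> 'M[C]_(a, b)) (z : C) : Prop :=
  forall (i : 'I_a) (k : 'I_b), exists l : C,
    forall e : R, 0 < e -> exists d : R, 0 < d /\
      forall h : C, h != 0 -> `|h| < d%:C ->
        `|(f (z + h) i k - f z i k) / h - l| < e%:C.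

Definition holo_on_lowerHP (a b : nat) (f : C -> 'M[C]_(a, b)) : Prop :=
  forall z, lowerHP z -> holo_at f z.

Definition discrete_in_lowerHP (D : C -> Prop) : Prop :=
  forall z, lowerHP z -> exists r : R, 0 < r /\
    forall w, D w -> w != z -> r%:C <= `|w - z|.

Definition meromorphic_lowerHP (a b : nat) (S : C -> Prop)
    (f : C -> 'M[C]_(a, b)) : Prop :=
  [/\ discrete_in_lowerHP S,
      (forall z, lowerHP z -> ~ S z -> holo_at f z) &
      (forall s, S s -> lowerHP s -> exists (n : nat) (g : C -> 'M[C]_(a, b)),
          holo_at g s /\ exists r : R, 0 < r /\
            forall w, w != s -> `|w - s| < r%:C -> g w = (w - s) ^+ n *: f w)].

Definition psd (p : nat) (A : 'M[C]_p) : Prop :=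
  forall v : 'cV[C]_p, 0 <= (adjmx v *m A *m v) 0 0.
Definition pd (p : nat) (A : 'M[C]_p) : Prop :=
  forall v : 'cV[C]_p, v != 0 -> 0 < (adjmx v *m A *m v) 0 0.

Section System.
Variable p : nat.

Definition jmx : 'M[C]_(p + p) := block_mx 1%:M 0 0 (- 1%:M).
Definition Jmx : 'M[C]_(p + p) := block_mx 0 1%:M 1%:M 0.
Definition Kmx : 'M[C]_(p + p) :=
  ((Num.sqrt (2 : R))^-1)%:C *: block_mx 1%:M (- 1%:M) 1%:M 1%:M.

Variable beta : nat -> 'M[C]_(p, p + p).

Definition Cmx (k : nat) : 'M[C]_(p + p) :=
  2%:R *: (adjmx Kmx *m adjmx (beta k) *m beta k *m Kmx) - jmx.

Fixpoint Wsol (k : nat) (lam : C) : 'M[C]_(p + p) :=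
  match k with
  | 0 => 1%:M
  | k'.+1 => Wsol k' lam - ('i / lam) *: (jmx *m Cmx k' *m Wsol k' lam)
  end.

Definition scrW (N : nat) (lam : C) : 'M[C]_(p + p) :=
  Kmx *m adjmx (Wsol N.+1 (Num.conj lam)).

Definition weyl_disc (N : nat) (phi : C -> 'M[C]_p) : Prop :=
  holo_on_lowerHP phi /\
  exists (Rf Qf : C -> 'M[C]_p) (S : C -> Prop),
    [/\ meromorphic_lowerHP S Rf, meromorphic_lowerHP S Qf, ~ S (- 'i),
        (forall lam, lowerHP lam -> ~ S lam ->
           pd (adjmx (Rf lam) *m Rf lam + adjmx (Qf lam) *m Qf lam)
           /\ psd (adjmx (Qf lam) *m Qf lam - adjmx (Rf lam) *m Rf lam)) &
        exists D : C -> Prop, discrete_in_lowerHP D /\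
          forall lam, lowerHP lam -> ~ S lam -> ~ D lam ->
            let M := scrW N lam in
            let den := ulsubmx M *m Rf lam + ursubmx M *m Qf lam in
            den \in unitmx /\
            phi lam = 'i *: ((dlsubmx M *m Rf lam + drsubmx M *m Qf lam)
                              *m invmx den)].
End System.
End Defs.

(* Main.v *)
Require Import Defs.
From mathcomp Require Import all_boot all_order all_algebra.
From mathcomp Require Import complex reals classical_sets ring lra.
Import Order.TTheory GRing.Theory Num.Theory.
Local Open Scope ring_scope.
Local Open Scope complex_scope.

(** With a = i/lam, which has negative real part, the disc N(N) is the orbit of
    the matrix contractions under T_0 ... T_N, T_k = 1 + a C_k j, followed by a
    Cayley transform.  The j-unitarity relation C_k j C_k = j gives
      M_k j T_k = (1 - a^2) j   for M_k = 1 - a j C_k,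
      form j (M_k y) = (1 + |a|^2) form j y - 2 Re a form C_k y,
    so T_k strictly shrinks the cone {form j <= 0}: the discs are nested.  As
    C_k >= j, a vector of positive j-form picks up a fixed fraction at every
    step, which bounds the squared diameter of the m-th disc by
    4 (1 + |a|^2) / (- 2 m Re a); this also covers lam = - i, where T_k is
    singular.  Hence the images th_{n,m} of 0 converge locally uniformly, and the
    limits satisfy th_n = (T_n ... T_{n+m-1})[th_{n+m}], so that the limit
    function lies in N(N) with R = th_{N+1}, Q = 1.

    The th_{n,m} are rational in a.  On a disc without poles a rational function
    is a uniform limit of polynomials (partial factors are geometric series), and
    for polynomials the Cauchy estimates follow by averaging over w and - w;
    thus the limit is holomorphic.

    Any other psi in all the discs satisfies the diameter estimate off the
    exceptional sets, and everywhere by continuity. *)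

Set Implicit Arguments.
Unset Strict Implicit.
Unset Printing Implicit Defensive.

(** * Hermitian forms *)

Section Forms.
Variable R : realType.
Local Notation C := R[i].

Lemma adjmxM a b c (A : 'M[C]_(a, b)) (B : 'M[C]_(b, c)) :
  adjmx (A *m B) = adjmx B *m adjmx A.
Proof. by rewrite /adjmx map_mxM trmx_mul. Qed.

Lemma adjmxK a b (A : 'M[C]_(a, b)) : adjmx (adjmx A) = A.
Proof. by apply/matrixP=> i k; rewrite !mxE conjCK. Qed.

Lemma adjmxD a b (A B : 'M[C]_(a, b)) : adjmx (A + B) = adjmx A + adjmx B.
Proof. by rewrite /adjmx map_mxD linearD. Qed.

Lemma adjmxN a b (A : 'M[C]_(a, b)) : adjmx (- A) = - adjmx A.
Proof. by rewrite /adjmx map_mxN linearN. Qed.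

Lemma adjmxB a b (A B : 'M[C]_(a, b)) : adjmx (A - B) = adjmx A - adjmx B.
Proof. by rewrite adjmxD adjmxN. Qed.

Lemma adjmxZ a b x (A : 'M[C]_(a, b)) : adjmx (x *: A) = Num.conj x *: adjmx A.
Proof. by rewrite /adjmx map_mxZ linearZ. Qed.

Lemma adjmx0 a b : adjmx (0 : 'M[C]_(a, b)) = 0.
Proof. by rewrite /adjmx map_mx0 trmx0. Qed.

Lemma adjmx1 n : adjmx (1%:M : 'M[C]_n) = 1%:M.
Proof. by rewrite /adjmx map_mx1 trmx1. Qed.

Lemma adjmx_col a1 a2 b (A : 'M[C]_(a1, b)) (B : 'M[C]_(a2, b)) :
  adjmx (col_mx A B) = row_mx (adjmx A) (adjmx B).
Proof. by rewrite /adjmx map_col_mx tr_col_mx. Qed.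

Lemma adjmx_row a b1 b2 (A : 'M[C]_(a, b1)) (B : 'M[C]_(a, b2)) :
  adjmx (row_mx A B) = col_mx (adjmx A) (adjmx B).
Proof. by rewrite /adjmx map_row_mx tr_row_mx. Qed.

Lemma adjmx_block a1 a2 b1 b2 (A : 'M[C]_(a1, b1)) (B : 'M[C]_(a1, b2))
    (A' : 'M[C]_(a2, b1)) (B' : 'M[C]_(a2, b2)) :
  adjmx (block_mx A B A' B') =
  block_mx (adjmx A) (adjmx A') (adjmx B) (adjmx B').
Proof. by rewrite /adjmx map_block_mx tr_block_mx. Qed.

Definition form n (A : 'M[C]_n) (v : 'cV[C]_n) : C := (adjmx v *m A *m v) 0 0.

Definition sqn n (v : 'cV[C]_n) : C := \sum_i `|v i 0| ^+ 2.

Lemma form1 n (v : 'cV[C]_n) : form 1%:M v = sqn v.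
Proof.
rewrite /form mulmx1 mxE; apply: eq_bigr => i _.
by rewrite !mxE mulrC -normCK.
Qed.

Lemma sqn_ge0 n (v : 'cV[C]_n) : 0 <= sqn v.
Proof. by apply: sumr_ge0 => i _; rewrite exprn_ge0. Qed.

Lemma ler_sqn n (v : 'cV[C]_n) i : `|v i 0| ^+ 2 <= sqn v.
Proof.
rewrite /sqn (bigD1 i) //= lerDl; apply: sumr_ge0 => k _.
by rewrite exprn_ge0.
Qed.

Lemma sqn_eq0 n (v : 'cV[C]_n) : (sqn v == 0) = (v == 0).
Proof.
apply/eqP/eqP => [v0|->]; last first.
  by apply: big1 => i _; rewrite mxE normr0 expr0n.
apply/matrixP=> i k; rewrite ord1 mxE; apply/eqP.
have := psumr_eq0P (fun j _ => exprn_ge0 2 (normr_ge0 (v j 0))) v0 isT.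
by move=> /(_ i)/eqP; rewrite expf_eq0 normr_eq0.
Qed.

Lemma sqn_gt0 n (v : 'cV[C]_n) : (0 < sqn v) = (v != 0).
Proof. by rewrite lt0r sqn_ge0 andbT sqn_eq0. Qed.

Lemma sqn0 n : sqn (0 : 'cV[C]_n) = 0.
Proof. by apply/eqP; rewrite sqn_eq0. Qed.

Lemma form_mul n k (A : 'M[C]_n) (B : 'M[C]_(n, k)) (v : 'cV[C]_k) :
  form A (B *m v) = form (adjmx B *m A *m B) v.
Proof. by rewrite /form adjmxM !mulmxA. Qed.

Lemma formD n (A B : 'M[C]_n) v : form (A + B) v = form A v + form B v.
Proof. by rewrite /form mulmxDr mulmxDl mxE. Qed.

Lemma formN n (A : 'M[C]_n) v : form (- A) v = - form A v.
Proof. by rewrite /form mulmxN mulNmx mxE. Qed.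

Lemma formB n (A B : 'M[C]_n) v : form (A - B) v = form A v - form B v.
Proof. by rewrite formD formN. Qed.

Lemma formZ n x (A : 'M[C]_n) v : form (x *: A) v = x * form A v.
Proof. by rewrite /form -scalemxAr -scalemxAl mxE. Qed.

Lemma form_scale n x (A : 'M[C]_n) v : form A (x *: v) = `|x| ^+ 2 * form A v.
Proof.
by rewrite /form adjmxZ -scalemxAr -!scalemxAl !mxE mulrA normCK.
Qed.

Lemma form_parallelogram n (A : 'M[C]_n) u v :
  form A (u + v) + form A (u - v) = 2%:R * (form A u + form A v).
Proof.
rewrite /form adjmxD adjmxB !(mulmxDl, mulmxDr, mulNmx, mulmxN).
move: (_ *m u) (_ *m v) (_ *m u) (_ *m v) => x y z t.
by rewrite !mxE; ring.
Qed.

Lemma form_col p (x y : 'cV[C]_p) : form (jmx R p) (col_mx x y) = sqn x - sqn y.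
Proof.
rewrite -!form1 /form /jmx adjmx_col mul_row_block mul_row_col.
rewrite !(mulmx0, addr0, add0r, mulmxN, mulNmx, mulmx1).
by rewrite !mxE.
Qed.
End Forms.

(** * The matrices j, J, K and C_k *)

Section JUnitary.
Variables (R : realType) (p : nat).
Local Notation C := R[i].
Local Notation j := (jmx R p).
Local Notation J := (Jmx R p).
Local Notation K := (Kmx R p).

Lemma unitmx_ker n (A : 'M[C]_n) :
  (forall v : 'cV[C]_n, A *m v = 0 -> v = 0) -> A \in unitmx.
Proof.
move=> kerA; rewrite -unitmx_tr -row_free_unit; apply: inj_row_free => v vA.
rewrite -[v]trmxK (kerA v^T) ?trmx0 //.
by rewrite -[A]trmxK -trmx_mul vA trmx0.
Qed.

Lemma jmx_adj : adjmx j = j.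
Proof. by rewrite /jmx adjmx_block adjmxN !adjmx1 !adjmx0. Qed.

Lemma jmx_sqr : j *m j = 1%:M.
Proof.
rewrite /jmx mulmx_block !(mulmx0, mul0mx, addr0, add0r, mulmx1, mul1mx).
by rewrite mulmxN mulmx1 opprK -scalar_mx_block.
Qed.

Lemma form_jmx (v : 'cV[C]_(p + p)) : form j (j *m v) = form j v.
Proof. by rewrite form_mul jmx_adj jmx_sqr mul1mx. Qed.

Let s : C := ((Num.sqrt (2 : R))^-1)%:C.

Let s_conj : Num.conj s = s.
Proof. exact: conjc_real. Qed.

Let s_sqr : s * s *+ 2 = 1.
Proof.
rewrite /s -rmorphM -rmorphMn -expr2 exprVn sqr_sqrtr ?ler0n //.
by rewrite -mulr_natr mulVf ?pnatr_eq0.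
Qed.

Let adjK : adjmx K = s *: block_mx 1%:M 1%:M (- 1%:M) 1%:M.
Proof. by rewrite adjmxZ s_conj adjmx_block adjmxN !adjmx1. Qed.

Let ss2 : (s * s) *: (1%:M *+ 2) = 1%:M :> 'M[C]_p.
Proof. by rewrite -scalerMnr scalerMnl s_sqr scale1r. Qed.

Lemma Kmx_mul_adj : K *m adjmx K = 1%:M.
Proof.
rewrite adjK /Kmx -scalemxAr -scalemxAl scalerA mulmx_block.
rewrite !(mulmx1, mul1mx, mulmxN, mulNmx, opprK) subrr.
rewrite -!mulr2n.
by rewrite scale_block_mx !scaler0 !ss2 -scalar_mx_block.
Qed.

Lemma adj_mul_Kmx : adjmx K *m K = 1%:M.
Proof. exact: mulmx1C Kmx_mul_adj. Qed.

Lemma Kmx_jmx : K *m j *m adjmx K = J.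
Proof.
have := ss2; rewrite adjK /Kmx /jmx /Jmx.
have: (1%:M : 'M[C]_p) *m 1%:M = 1%:M by rewrite mulmx1.
move: (1%:M : 'M[C]_p) => I I1 sI.
rewrite -!scalemxAl -scalemxAr scalerA !mulmx_block.
rewrite !(mulmxN, mulNmx, mulmx0, mul0mx) !I1 !(mulmxN, mulNmx, oppr0, opprK, addr0, add0r) !I1.
by rewrite subrr -mulr2n scale_block_mx scaler0 sI.
Qed.

Lemma Kmx_col (x y : 'M[C]_p) : K *m col_mx x y = s *: col_mx (x - y) (x + y).
Proof.
by rewrite /Kmx -scalemxAl mul_block_col mulNmx !mul1mx.
Qed.

Lemma adj_Kmx_col (x y : 'M[C]_p) :
  adjmx K *m col_mx x y = s *: col_mx (x + y) (y - x).
Proof.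
by rewrite adjK -scalemxAl mul_block_col mulNmx !mul1mx [- x + y]addrC.
Qed.

Variable b : 'M[C]_(p, p + p).
Hypothesis bjb : b *m j *m adjmx b = 1%:M.

(** In blocks, [b j adjmx b = 1] reads [b1 adjmx b1 = 1 + b2 adjmx b2], so [adjmx b1] is invertible
    and [x1 = adjmx b1 w]. Expanding [|adjmx b2 w + x2|^2 >= 0] with [b2 x2 = - b1 x1] then yields
    [|x2|^2 >= |x1|^2 + |w|^2]. *)
Lemma form_ker_lt0 (x : 'cV[C]_(p + p)) :
  b *m x = 0 -> x != 0 -> form j x < 0.
Proof.
move: bjb; rewrite -[b]hsubmxK -[x]vsubmxK.
move: (lsubmx b) (rsubmx b) (usubmx x) (dsubmx x) => b1 b2 x1 x2.
rewrite /jmx mul_row_block adjmx_row !mul_row_col.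
rewrite !(mulmx0, addr0, add0r, mulmxN, mulNmx, mulmx1) => b12 bx x0.
have b1b1 : b1 *m adjmx b1 = 1%:M + b2 *m adjmx b2.
  by rewrite -b12 subrK.
have sq1 w : sqn (adjmx b1 *m w) = sqn w + sqn (adjmx b2 *m w).
  by rewrite -!form1 !form_mul !mulmx1 !adjmxK b1b1 formD.
have b1u : adjmx b1 \in unitmx.
  apply: unitmx_ker => w w0; apply/eqP; rewrite -sqn_eq0 eq_le sqn_ge0 andbT.
  by have := sq1 w; rewrite w0 sqn0 => /eqP; rewrite eq_sym addr_eq0 => /eqP ->;
    rewrite oppr_le0 sqn_ge0.
pose w := invmx (adjmx b1) *m x1.
have x1E : x1 = adjmx b1 *m w by rewrite mulmxA mulmxV // mul1mx.
move: w x1E => w x1E.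
have b2x2 : b2 *m x2 = - (b1 *m x1) by apply/eqP; rewrite -addr_eq0 addrC bx.
have H : sqn (adjmx b2 *m w + x2) =
    sqn (adjmx b2 *m w) + sqn x2 - (sqn x1 + sqn x1).
  rewrite -!form1 /form !mulmx1 adjmxD !(mulmxDl, mulmxDr).
  have E : adjmx w *m b2 *m x2 = - (adjmx x1 *m x1).
    by rewrite -mulmxA b2x2 mulmxN x1E adjmxM adjmxK !mulmxA.
  have E' : adjmx x2 *m (adjmx b2 *m w) = - (adjmx x1 *m x1).
    apply: (can_inj (@adjmxK _ _ _)).
    by rewrite adjmxN !adjmxM !adjmxK E.
  rewrite [X in X *m x2]adjmxM adjmxK E E'.
  move: (_ *m _) (_ *m _) (_ *m _) => u v t.
  by rewrite !mxE; ring.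
rewrite form_col subr_lt0.
have := sqn_ge0 (adjmx b2 *m w + x2); rewrite H {1}x1E sq1 => le2.
have le3 : sqn x1 + sqn w <= sqn x2.
  rewrite -subr_ge0; apply: le_trans le2 _; rewrite le_eqVlt; apply/orP; left.
  by apply/eqP; ring.
(* If [w = 0] then [x1 = 0], and strictness comes from [x2 != 0] instead. *)
have [w0|w0] := eqVneq w 0.
  move: x0 le3; rewrite x1E w0 mulmx0 sqn0 => x0 _; rewrite sqn_gt0.
  by apply: contraNneq x0 => ->; rewrite col_mx0.
by apply: lt_le_trans le3; rewrite ltrDl sqn_gt0.
Qed.

Let Q := adjmx b *m b.

Let Q_adj : adjmx Q = Q.
Proof. by rewrite adjmxM adjmxK. Qed.

Let QjQ : Q *m j *m Q = Q.
Proof.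
by rewrite /Q -!mulmxA (mulmxA b) (mulmxA _ (adjmx b)) bjb mul1mx.
Qed.

Let form_Q v : form Q v = sqn (b *m v).
Proof. by rewrite -form1 form_mul mulmx1. Qed.

(** Since [QjQ = Q], the matrix [1 - jQ] is the j-orthogonal projection onto the kernel of [b]; this
    is Pythagoras for that splitting. *)
Lemma form_compl (v : 'cV[C]_(p + p)) :
  form j (v - j *m Q *m v) = form j v - sqn (b *m v).
Proof.
have -> : v - j *m Q *m v = (1%:M - j *m Q) *m v by rewrite mulmxBl mul1mx.
rewrite form_mul adjmxB adjmxM adjmx1 jmx_adj Q_adj -form_Q -formB.
congr form; have := QjQ; have := jmx_sqr; move: Q j => q i i2 qiq.
rewrite mulmxBl mul1mx -mulmxA i2 mulmx1.
by rewrite mulmxBr mulmx1 mulmxBl !mulmxA i2 mul1mx qiq subrr subr0.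
Qed.

Definition Cmx_of : 'M[C]_(p + p) := 2%:R *: Q - j.

Lemma form_Cmx_of v : form Cmx_of v = 2%:R * sqn (b *m v) - form j v.
Proof. by rewrite formB formZ form_Q. Qed.

Lemma b_compl (v : 'cV[C]_(p + p)) : b *m (v - j *m Q *m v) = 0.
Proof. by rewrite mulmxBr !mulmxA bjb mul1mx subrr. Qed.

(** Here [C - j = 2 (Q - j)], and by [form_compl] the form of [j - Q] at [v] is the j-form of a
    vector in the kernel of [b], hence nonpositive. *)
Lemma ler_form_Cmx_of v : form j v <= form Cmx_of v.
Proof.
rewrite form_Cmx_of -subr_ge0.
have -> : 2%:R * sqn (b *m v) - form j v - form j v
   = - 2%:R * (form j v - sqn (b *m v)) by ring.
rewrite -form_compl mulNr -mulrN mulr_ge0 ?ler0n // oppr_ge0.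
have [->|x0] := eqVneq (v - j *m Q *m v) 0; first by rewrite /form mulmx0 mxE.
exact/ltW/form_ker_lt0/x0/b_compl.
Qed.

(** The form is [|b v|^2] minus the j-form of the projection of [v] on the kernel of [b]: two
    nonnegative terms, which vanish together only at [v = 0]. *)
Lemma form_Cmx_of_gt0 v : v != 0 -> 0 < form Cmx_of v.
Proof.
move=> v0; have -> : form Cmx_of v = sqn (b *m v) - form j (v - j *m Q *m v).
  by rewrite form_Cmx_of form_compl; ring.
have [x0|x0] := eqVneq (v - j *m Q *m v) 0; last first.
  by rewrite ltr_wpDl ?sqn_ge0 // oppr_gt0; apply: form_ker_lt0 x0; apply: b_compl.
rewrite x0 /form mulmx0 mxE subr0 sqn_gt0; apply: contraNneq v0 => bv.
by move/eqP: x0; rewrite subr_eq0 -!mulmxA bv !mulmx0.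
Qed.

Lemma form_Cmx_of_ge0 v : 0 <= form Cmx_of v.
Proof.
have [->|/form_Cmx_of_gt0/ltW//] := eqVneq v 0; by rewrite /form mulmx0 mxE.
Qed.

Lemma Cmx_of_adj : adjmx Cmx_of = Cmx_of.
Proof. by rewrite adjmxB adjmxZ conjC_nat jmx_adj Q_adj. Qed.

(** Because [QjQ = Q], expanding [(2Q - j) j (2Q - j)] leaves [4Q - 2Q - 2Q + j]. *)
Lemma Cmx_of_jmx : Cmx_of *m j *m Cmx_of = j.
Proof.
rewrite /Cmx_of; have := QjQ; have := jmx_sqr; move: Q j => q i i2 qiq.
rewrite mulmxBl i2 mulmxBr mulmxBl mul1mx -!scalemxAl -!scalemxAr qiq.
rewrite mulmxBl mul1mx -scalemxAl -(mulmxA q) i2 mulmx1 opprB addrA.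
by rewrite scalerA mulr_natl -scalerMnl mulr2n addrK [_ + i]addrC addrK.
Qed.
End JUnitary.

(** * Products of the transfer matrices *)

Section Transfer.
Variables (R : realType) (p : nat) (beta : nat -> 'M[R[i]]_(p, p + p)).
Local Notation C := R[i].
Local Notation j := (jmx R p).
Local Notation K := (Kmx R p).

(** With [a = i/lam], [Mmx] is one step of the system, and [Tmx] is the adjoint of the step taken at
    the conjugate of [lam]. *)
Definition Tmx (a : C) (k : nat) : 'M[C]_(p + p) :=
  1%:M + a *: (Cmx beta k *m j).
Definition Mmx (a : C) (k : nat) : 'M[C]_(p + p) :=
  1%:M - a *: (j *m Cmx beta k).

(** The products are [T_n ... T_(n+m-1)] and, in the opposite order, [M_(n+m-1) ... M_n]. The disc
    of index [N] therefore uses [prodT a 0 N.+1]. *)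
Fixpoint prodT (a : C) (n m : nat) : 'M[C]_(p + p) :=
  if m is m'.+1 then prodT a n m' *m Tmx a (n + m') else 1%:M.
Fixpoint prodM (a : C) (n m : nat) : 'M[C]_(p + p) :=
  if m is m'.+1 then Mmx a (n + m') *m prodM a n m' else 1%:M.

Lemma prodT_add a n m l : prodT a n (m + l) = prodT a n m *m prodT a (n + m) l.
Proof.
elim: l => [|l IH]; first by rewrite addn0 mulmx1.
by rewrite addnS /= IH mulmxA addnA.
Qed.

Hypothesis hbeta : forall k, beta k *m Jmx R p *m adjmx (beta k) = 1%:M.

Let b k := beta k *m K.

(** The relation [K j adjmx K = J] turns the J-normalisation of [beta k] into the j-normalisation
    required of [b]. *)
Let bjb k : b k *m j *m adjmx (b k) = 1%:M.
Proof.
by rewrite /b adjmxM mulmxA -(mulmxA (beta k)) -(mulmxA (beta k)) Kmx_jmx hbeta.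
Qed.

Let CmxE k : Cmx beta k = Cmx_of (b k).
Proof. by rewrite /Cmx /Cmx_of /b adjmxM !mulmxA. Qed.

Lemma Cmx_adj k : adjmx (Cmx beta k) = Cmx beta k.
Proof. by rewrite CmxE Cmx_of_adj. Qed.

Lemma Cmx_jmx k : Cmx beta k *m j *m Cmx beta k = j.
Proof. by rewrite CmxE Cmx_of_jmx. Qed.

Lemma ler_form_Cmx k v : form j v <= form (Cmx beta k) v.
Proof. by rewrite CmxE ler_form_Cmx_of. Qed.

Lemma form_Cmx_gt0 k v : v != 0 -> 0 < form (Cmx beta k) v.
Proof. by rewrite CmxE; apply: form_Cmx_of_gt0. Qed.

Lemma form_Cmx_ge0 k v : 0 <= form (Cmx beta k) v.
Proof. by rewrite CmxE form_Cmx_of_ge0. Qed.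

Lemma adj_Mmx a k : adjmx (Mmx a k) = Tmx (- Num.conj a) k.
Proof.
by rewrite adjmxB adjmxZ adjmxM adjmx1 jmx_adj Cmx_adj /Tmx scaleNr.
Qed.

Lemma Mmx_j_Tmx a k : Mmx a k *m j *m Tmx a k = (1 - a ^+ 2) *: j.
Proof.
rewrite /Mmx /Tmx; have := jmx_sqr R p; have := Cmx_jmx k.
move: (Cmx beta k) j => c i cic i2.
have cc : i *m c *m i *m (c *m i) = i.
  by rewrite -(mulmxA i) -(mulmxA i) (mulmxA (c *m i)) cic i2 mulmx1.
have ic : i *m (c *m i) = i *m c *m i by rewrite mulmxA.
rewrite mulmxBl mul1mx -scalemxAl mulmxDr mulmx1 -scalemxAr mulmxBl -scalemxAl.
rewrite cc ic scalerBr scalerA scalerBl scale1r expr2.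
by rewrite addrA subrK.
Qed.

Lemma form_Tmx a k v : form j (Tmx a k *m v) =
  (1 + `|a| ^+ 2) * form j v + (a + Num.conj a) * form (Cmx beta k) (j *m v).
Proof.
rewrite !form_mul -!formZ -formD; congr form.
rewrite /Tmx adjmxD adjmxZ adjmxM adjmx1 jmx_adj Cmx_adj.
have := jmx_sqr R p; have := Cmx_jmx k.
move: (Cmx beta k) j => c i cic i2.
have cc : i *m c *m i *m (c *m i) = i.
  by rewrite -(mulmxA i) -(mulmxA i) (mulmxA (c *m i)) cic i2 mulmx1.
have ic : i *m (c *m i) = i *m c *m i by rewrite mulmxA.
rewrite mulmxDl mul1mx -scalemxAl mulmxDr mulmx1 -scalemxAr mulmxDl -scalemxAl.
rewrite cc ic normCK; move: (i *m c *m i) (Num.conj a) => x a'.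
by apply/matrixP => s t; rewrite !mxE; ring.
Qed.

Lemma form_Mmx a k v : form j (Mmx a k *m v) =
  (1 + `|a| ^+ 2) * form j v - (a + Num.conj a) * form (Cmx beta k) v.
Proof.
rewrite !form_mul -!formZ -formB; congr form.
rewrite adj_Mmx /Mmx /Tmx scaleNr.
have := jmx_sqr R p; have := Cmx_jmx k.
move: (Cmx beta k) j => c i cic i2.
have cc : c *m (i *m c) = i by rewrite mulmxA cic.
have -> : (1%:M - Num.conj a *: (c *m i)) *m i = i - Num.conj a *: c.
  by rewrite mulmxBl mul1mx -scalemxAl -mulmxA i2 mulmx1.
rewrite mulmxBr mulmx1 -scalemxAr mulmxBl mulmxA i2 mul1mx -scalemxAl cc.
rewrite normCK; move: (Num.conj a) => a'.
by apply/matrixP => s t; rewrite !mxE; ring.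
Qed.

Lemma prodM_j_prodT a n m : prodM a n m *m j *m prodT a n m = (1 - a ^+ 2) ^+ m *: j.
Proof.
elim: m => [|m IH]; first by rewrite /= mul1mx mulmx1 expr0 scale1r.
rewrite /= mulmxA -(mulmxA (Mmx _ _)) -(mulmxA (Mmx _ _)) IH -scalemxAr -scalemxAl.
by rewrite Mmx_j_Tmx scalerA [in RHS]exprSr.
Qed.

Lemma adj_prodM a n m : adjmx (prodM a n m) = prodT (- Num.conj a) n m.
Proof.
by elim: m => [|m IH]; rewrite /= ?adjmx1 // adjmxM IH adj_Mmx.
Qed.

Lemma Wsol_prodM lam k : Wsol beta k lam = prodM ('i / lam) 0 k.
Proof.
elim: k => //= k ->; by rewrite /Mmx add0n mulmxBl mul1mx -scalemxAl.
Qed.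

Lemma scrW_prodT lam N : scrW beta N lam = K *m prodT ('i / lam) 0 N.+1.
Proof.
rewrite /scrW Wsol_prodM adj_prodM; congr (_ *m prodT _ _ _).
rewrite rmorphM /= fmorphV /= conjCK.
by rewrite conjCi mulNr opprK.
Qed.

Variable a : C.
Hypothesis ha : a + Num.conj a < 0.

Let q : C := 1 + `|a| ^+ 2.
Let c : C := - (a + Num.conj a).
Let q_gt0 : 0 < q. Proof. by rewrite ltr_wpDr ?exprn_ge0. Qed.
Let c_gt0 : 0 < c. Proof. by rewrite oppr_gt0. Qed.

Lemma form0 n (A : 'M[C]_n) : form A 0 = 0.
Proof. by rewrite /form mulmx0 mxE. Qed.

(** On the cone the first term of [form_Tmx] is nonpositive; the second is strictly negative, [C_k]
    being positive definite and the real part of [a] negative. *)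
Lemma Tmx_lt0 k v : v != 0 -> form j v <= 0 -> form j (Tmx a k *m v) < 0.
Proof.
move=> v0 jv; rewrite form_Tmx -/q -[X in _ + X]opprK -mulNr -/c subr_lt0.
apply: (@le_lt_trans _ _ 0); first by rewrite pmulr_rle0.
rewrite mulr_gt0 // form_Cmx_gt0 //.
by apply: contraNneq v0 => jv0; rewrite -[v]mul1mx -(jmx_sqr R p) -mulmxA jv0 mulmx0.
Qed.

Lemma prodT_le0 n m v : v != 0 -> form j v <= 0 ->
  prodT a n m *m v != 0 /\ form j (prodT a n m *m v) <= 0.
Proof.
elim: m v => [|m IH] v v0 jv /=; first by rewrite mul1mx.
rewrite -mulmxA; have lt0 := Tmx_lt0 (n + m) v0 jv.
apply: IH; last exact: ltW.
by apply: contraTneq lt0 => ->; rewrite form0 ltxx.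
Qed.

Lemma prodT_lt0 n m v : v != 0 -> form j v <= 0 -> form j (prodT a n m.+1 *m v) < 0.
Proof.
move=> v0 jv; rewrite -[m.+1]/(1 + m)%N prodT_add -mulmxA /= mul1mx.
by have [] := prodT_le0 (n + 1) m v0 jv; apply: Tmx_lt0.
Qed.

(** The excess of the j-form over pure growth by the factor [q] per step. It is a nonnegative
    quadratic form in [v], so it obeys the parallelogram law used in [prodT_diam]. *)
Let e n m v := form j (prodM a n m *m v) - q ^+ m * form j v.

Let eS n m v :
  e n m.+1 v = q * e n m v + c * form (Cmx beta (n + m)) (prodM a n m *m v).
Proof.
rewrite /e /= -mulmxA form_Mmx (exprS q) -/q.
have -> : a + Num.conj a = - c by rewrite opprK.
move: (prodM a n m *m v) (q ^+ m) q c => w qm x y.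
move: (form _ _) (form _ _) (form _ _) => z t u; ring.
Qed.

Let e_ge0 n m v : 0 <= e n m v.
Proof.
elim: m => [|m IH]; first by rewrite /e /= mul1mx expr0 mul1r subrr.
by rewrite eS addr_ge0 // mulr_ge0 ?form_Cmx_ge0 // ltW.
Qed.

(** Each step contributes at least [c q^m form j v], because [C_k >= j] and the j-form has already
    grown by [q^m]. The factor [q] on the right avoids the exponent [m - 1]. *)
Let e_lower n m v : 0 <= form j v ->
  c * m%:R * q ^+ m * form j v <= q * e n m v.
Proof.
move=> jv; elim: m => [|m IH].
  by rewrite mulr0 !mul0r mulr_ge0 ?e_ge0 // ltW.
have -> : c * m.+1%:R * q ^+ m.+1 * form j v =
   q * (c * m%:R * q ^+ m * form j v) + q * (c * (q ^+ m * form j v)).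
  by rewrite -natr1 (exprS q); move: q c (form j v) => x y z; ring.
rewrite eS mulrDr lerD //; first by rewrite ler_pM2l.
rewrite ler_pM2l // ler_pM2l //; apply: le_trans (ler_form_Cmx _ _).
by rewrite -subr_ge0; apply: e_ge0.
Qed.

(** For [v = prodT w] with [w] in the cone, [prodM j v] is a scalar multiple of [j w], so
    [e (j v) <= - q^m form j v]. On the difference [j v1 - j v2] the lower bound [e_lower] competes
    with the parallelogram bound, and [q^m] cancels. *)
Lemma prodT_diam n m v1 v2 w1 w2 :
    v1 = prodT a n m *m w1 -> v2 = prodT a n m *m w2 ->
    form j w1 <= 0 -> form j w2 <= 0 -> 0 <= form j (v1 - v2) ->
  c * m%:R * form j (v1 - v2) <= - (2%:R * q * (form j v1 + form j v2)).
Proof.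
move=> v1E v2E jw1 jw2 jd.
have e_le v w : v = prodT a n m *m w -> form j w <= 0 ->
    e n m (j *m v) <= - (q ^+ m * form j v).
  move=> -> jw; rewrite /e form_jmx mulmxA mulmxA prodM_j_prodT -scalemxAl.
  by rewrite form_scale form_jmx gerDr mulr_ge0_le0 ?exprn_ge0.
have qm_gt0 : 0 < q ^+ m by rewrite exprn_gt0.
rewrite -(ler_pM2r qm_gt0).
have -> : c * m%:R * form j (v1 - v2) * q ^+ m =
    c * m%:R * q ^+ m * form j (j *m v1 - j *m v2).
  by rewrite -mulmxBr form_jmx; move: (q ^+ m) (form _ _) c => x y z; ring.
apply: le_trans (e_lower n m _) _; first by rewrite -mulmxBr form_jmx.
have -> : - (2%:R * q * (form j v1 + form j v2)) * q ^+ m =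
   q * (2%:R * (- (q ^+ m * form j v1) + - (q ^+ m * form j v2))).
  by move: (form j v1) (form j v2) (q ^+ m) q => x y z t; ring.
rewrite ler_pM2l //.
apply: (@le_trans _ _ (2%:R * (e n m (j *m v1) + e n m (j *m v2)))); last first.
  rewrite ler_pM2l ?ltr0n //.
  by apply: lerD; [apply: e_le v1E jw1 | apply: e_le v2E jw2].
(* By the parallelogram law the value of [e] at the difference is bounded once its nonnegative value
   at the sum is dropped. *)
have -> : 2%:R * (e n m (j *m v1) + e n m (j *m v2)) =
    e n m (j *m v1 + j *m v2) + e n m (j *m v1 - j *m v2).
  have aux t A1 A2 X1 X2 Bp Bm Yp Ym : Bp + Bm = 2%:R * (A1 + A2) ->
      Yp + Ym = 2%:R * (X1 + X2) ->
      2%:R * (A1 - t * X1 + (A2 - t * X2)) = Bp - t * Yp + (Bm - t * Ym) :> C.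
    move=> E1 E2; have -> : Bp - t * Yp + (Bm - t * Ym) =
      (Bp + Bm) - t * (Yp + Ym) by ring.
    by rewrite E1 E2; ring.
  by rewrite /e mulmxDr mulmxBr; apply: aux; apply: form_parallelogram.
by rewrite lerDr e_ge0.
Qed.

End Transfer.

(** * Cauchy estimates for polynomials *)

Section PolyBounds.
Variable C : numClosedFieldType.

(* The even part of P is E(X^2) with |E| <= B on the circle of radius r^2 and
   E(0) = P(0); iterating halves the degree down to a constant. *)
Lemma poly_center_bound (P : {poly C}) (r B : C) : 0 < r ->
  (forall w, `|w| = r -> `|P.[w]| <= B) -> `|P.[0]| <= B.
Proof.
have [n] := ubnP (size P); elim: n P r => // n IH P r sP r0 PB.
have [sP1|sP1] := leqP (size P) 1.
  rewrite (size1_polyC sP1) hornerC.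
  by have := PB r (gtr0_norm r0); rewrite {1}(size1_polyC sP1) hornerC.
have -> : P.[0] = (even_poly P).[0] by rewrite !horner_coef0 coef_even_poly.
apply: (IH _ (r ^+ 2)); rewrite ?exprn_gt0 //.
  apply: leq_ltn_trans (size_even_poly P) _.
  apply: leq_trans _ (sP : (size P <= n)%N).
  by case: (size P) sP1 => [|[|k]] // _; rewrite uphalfE ltn_half_double -addnn !addSn !addnS !ltnS leq_addr.
move=> s sr; pose w := sqrtC s.
have w2 : w ^+ 2 = s by rewrite sqrtCK.
have wr : `|w| = r.
  by apply/eqP; rewrite -(eqrXn2 (n := 2)) ?normr_ge0 ?ltW // -normrX w2 sr.
have PE t : t ^+ 2 = s -> P.[t] = (even_poly P).[s] + (odd_poly P).[s] * t.
  by move=> ts; rewrite -{1}(poly_even_odd P) hornerD hornerM !horner_comp hornerXn hornerX ts.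
have E2 : (even_poly P).[s] *+ 2 = P.[w] + P.[- w].
  by rewrite (PE w) // (PE (- w)) ?sqrrN //; ring.
rewrite -(ler_pMn2r (isT : (0 < 2)%N)) -normrMn E2 mulr2n.
apply: le_trans (ler_normD _ _) _.
by rewrite lerD // PB // normrN.
Qed.

(** Induction on [P X + c]: [|c| <= B] by the centre bound, so [|P| <= 2B/r] on the circle, and
    inductively [|P h| <= 4B/r]. The radius [r/4] is what makes [|P h * h| <= B], closing the
    induction with the same constant 2. *)
Lemma poly_small_bound (P : {poly C}) (r B h : C) : 0 < r ->
  (forall w, `|w| = r -> `|P.[w]| <= B) -> `|h| <= r / 4%:R ->
  `|P.[h]| <= 2%:R * B.
Proof.
move=> r0; elim/poly_ind: P B => [|P c IH] B PB hr.
  have := PB r (gtr0_norm r0); rewrite !horner0 normr0 => B0.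
  by rewrite mulr_ge0 ?ler0n.
have cB : `|c| <= B.
  by have := poly_center_bound r0 PB; rewrite hornerMXaddC mulr0 add0r.
have P'B w : `|w| = r -> `|P.[w]| <= 2%:R * B / r.
  move=> wr; rewrite ler_pdivlMr // -wr -normrM.
  have -> : P.[w] * w = (P * 'X + c%:P).[w] - c.
    by rewrite hornerMXaddC addrK.
  apply: le_trans (ler_normB _ _) _.
  by rewrite mulr_natl mulr2n lerD ?PB.
rewrite hornerMXaddC; apply: le_trans (ler_normD _ _) _.
rewrite mulr_natl mulr2n lerD // normrM.
apply: le_trans (ler_pM _ _ (IH _ P'B hr) hr) _ => //.
by rewrite le_eqVlt; apply/orP; left; apply/eqP; field; rewrite gt_eqF.
Qed.

(** Two coefficients are split off. Each division by the variable doubles the bound on the circle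
    and divides it by [r], so the quotient is at most [4B/r^2] there; [poly_small_bound] doubles
    this once more. *)
Lemma poly_taylor1 (P : {poly C}) (r B : C) : 0 < r ->
  (forall w, `|w| = r -> `|P.[w]| <= B) ->
  `|P`_1| <= 2%:R * B / r /\
  forall h, `|h| <= r / 4%:R ->
    `|P.[h] - P.[0] - P`_1 * h| <= 8%:R * B / r ^+ 2 * `|h| ^+ 2.
Proof.
move=> r0; elim/poly_ind: P => [|P c _] PB.
  have := PB r (gtr0_norm r0); rewrite horner0 normr0 coef0 normr0 => B0.
  split=> [|h _]; first by rewrite divr_ge0 ?mulr_ge0 ?ler0n ?(ltW r0).
  rewrite !horner0 mul0r !subr0 normr0.
  by rewrite mulr_ge0 ?exprn_ge0 // divr_ge0 ?exprn_ge0 ?mulr_ge0 ?ler0n ?(ltW r0).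
have cB : `|c| <= B.
  by have := poly_center_bound r0 PB; rewrite hornerMXaddC mulr0 add0r.
have : forall w, `|w| = r -> `|P.[w]| <= 2%:R * B / r.
  move=> w wr; rewrite ler_pdivlMr // -wr -normrM.
  have -> : P.[w] * w = (P * 'X + c%:P).[w] - c.
    by rewrite hornerMXaddC addrK.
  apply: le_trans (ler_normB _ _) _.
  by rewrite mulr_natl mulr2n lerD ?PB.
have -> : (P * 'X + c%:P)`_1 = P.[0].
  by rewrite coefD coefMX coefC addr0 horner_coef0.
(* Second splitting: the constant term [d] of the first quotient is the linear coefficient of the
   original polynomial. *)
move: {PB} P => P; elim/poly_ind: P => [|P d _] PB.
  have := PB r (gtr0_norm r0); rewrite horner0 normr0 => B0.
  split=> [|h _]; first by rewrite horner0 normr0.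
  rewrite !hornerMXaddC !(horner0, mul0r, add0r, subrr, oppr0, normr0).
  have -> : 8%:R * B / r ^+ 2 = 4%:R * (2%:R * B / r) / r.
    by field; rewrite gt_eqF.
  by rewrite mulr_ge0 ?exprn_ge0 // divr_ge0 ?(ltW r0) // mulr_ge0 ?ler0n.
have dB := poly_center_bound r0 PB; split=> // h hr.
rewrite !hornerMXaddC !mulr0 !add0r in dB *.
have P'B w : `|w| = r -> `|P.[w]| <= 4%:R * B / r ^+ 2.
  move=> wr.
  have -> : 4%:R * B / r ^+ 2 = (2%:R * B / r + 2%:R * B / r) / r.
    by field; rewrite gt_eqF.
  rewrite ler_pdivlMr // -wr -normrM wr.
  have -> : P.[w] * w = (P * 'X + d%:P).[w] - d.
    by rewrite hornerMXaddC addrK.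
  apply: le_trans (ler_normB _ _) _.
  by rewrite lerD ?PB.
have -> : (P.[h] * h + d) * h + c - c - d * h = P.[h] * h ^+ 2 by ring.
rewrite normrM normrX ler_wpM2r ?exprn_ge0 //.
apply: le_trans (poly_small_bound r0 P'B hr) _.
by rewrite le_eqVlt; apply/orP; left; apply/eqP; field; rewrite gt_eqF.
Qed.

Lemma bernoulli_ge (x : C) n : 0 <= x -> 1 + n%:R * x <= (1 + x) ^+ n.
Proof.
move=> x0; elim: n => [|n IH]; first by rewrite mul0r addr0 expr0.
rewrite exprS; apply: (@le_trans _ _ ((1 + x) * (1 + n%:R * x))).
  rewrite -subr_ge0.
  have -> : (1 + x) * (1 + n%:R * x) - (1 + n.+1%:R * x) = n%:R * x ^+ 2.
    by rewrite -natr1; ring.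
  by rewrite mulr_ge0 ?ler0n ?exprn_ge0.
by rewrite ler_pM2l // ltr_wpDr.
Qed.
End PolyBounds.

(** * Archimedean property and completeness of the complex numbers *)

Section Completeness.
Variable R : realType.
Local Notation C := R[i].

Lemma archi_complex (x e : C) : 0 < e -> x \is Num.real ->
  exists n : nat, x <= e * n%:R.
Proof.
move=> e0 /complex_realP[y ->].
have /complex_realP[d dE] : e \is Num.real by rewrite gtr0_real.
move: e0; rewrite {}dE ltcR => d0.
exists (Num.Def.truncn (y / d)).+1.
rewrite -(rmorph_nat (real_complex R)) -rmorphM lecR mulrC -ler_pdivrMr //.
exact/ltW/truncnS_gt.
Qed.

(** Bernoulli's inequality for the powers of [x^-1 = 1 + (x^-1 - 1)]. *)
Lemma expr_small (x e : C) : 0 <= x -> x < 1 -> 0 < e -> exists n, x ^+ n <= e.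
Proof.
move=> x0 x1 e0; have [->|xn0] := eqVneq x 0.
  by exists 1%N; rewrite expr1 ltW.
have xp : 0 < x by rewrite lt0r xn0.
have y0 : 0 < x^-1 - 1 by rewrite subr_gt0 invf_gt1.
have [n nE] := @archi_complex e^-1 _ y0 (gtr0_real (etrans (invr_gt0 e) e0)).
exists n; rewrite -[x]invrK exprVn -[e]invrK lef_pV2 ?posrE ?exprn_gt0 ?invr_gt0 //.
apply: le_trans nE _; rewrite mulrC.
have := @bernoulli_ge C (x^-1 - 1) n (ltW y0); rewrite [1 + (_ - 1)]addrC subrK => le1.
by apply: le_trans le1; rewrite lerDr ler01.
Qed.

(** The limit is the supremum of the eventual lower bounds of [u], that is, its lower limit; the
    Cauchy condition places [u N - e] below this supremum and [u N + e] above it. *)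
Lemma real_cauchy (u : nat -> R) :
  (forall e, 0 < e -> exists N, forall n, (N <= n)%N -> `|u n - u N| <= e) ->
  exists l, forall e, 0 < e -> exists N, forall n, (N <= n)%N -> `|u n - l| <= e.
Proof.
move=> cu.
pose S : set R := fun x => exists N, forall n, (N <= n)%N -> x <= u n.
have upS e N : (forall n, (N <= n)%N -> `|u n - u N| <= e) -> forall x, S x -> x <= u N + e.
  move=> uN x [M xM]; apply: le_trans (xM _ (leq_maxl M N)) _.
  by have := uN _ (leq_maxr M N); rewrite ler_distlC => /andP[]; lra.
have loS e N : (forall n, (N <= n)%N -> `|u n - u N| <= e) -> S (u N - e).
  move=> uN; exists N => n /uN; rewrite ler_norml => /andP[]; lra.
have hS : has_sup S.
  have [N uN] := cu 1 ltr01; split; first by exists (u N - 1); apply: loS.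
  by exists (u N + 1) => x; apply: upS.
exists (sup S) => e e0.
have [N uN] := cu (e / 2) (divr_gt0 e0 (ltr0n _ 2)); exists N => n Nn.
have l1 : sup S <= u N + e / 2 by apply: ge_sup; [case: hS | apply: upS].
have l2 : u N - e / 2 <= sup S by apply: sup_upper_bound => //; apply: loS.
by have := uN n Nn; rewrite !ler_norml => /andP[]; lra.
Qed.

Lemma norm_le_ReIm (x : C) : `|x| <= `|complex.Re x|%:C + `|complex.Im x|%:C.
Proof.
rewrite {1}[x]complexE; apply: le_trans (ler_normD _ _) _.
have nR (y : R) : `|y%:C| = `|y|%:C :> C.
  by rewrite normc_def /= expr0n addr0 sqrtr_sqr.
rewrite normrM !nR.
have -> : `|'i%C| = 1 :> C by rewrite normc_def /= expr0n expr1n add0r sqrtr1.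
by rewrite mul1r.
Qed.

Lemma complex_cauchy (u : nat -> C) :
  (forall e, 0 < e -> exists N, forall n, (N <= n)%N -> `|u n - u N| <= e) ->
  exists l, forall e, 0 < e -> exists N, forall n, (N <= n)%N -> `|u n - l| <= e.
Proof.
move=> cu.
have normRe x : `|complex.Re x|%:C <= `|x| := @normc_ge_Re R x.
have normIm (x : C) : `|complex.Im x|%:C <= `|x|.
  have := normRe (x * 'i%C); rewrite ReiNIm normrN => /le_trans; apply.
  rewrite normrM; have -> : `|'i%C| = 1 :> C.
    by rewrite normc_def /= expr0n expr1n add0r sqrtr1.
  by rewrite mulr1.
have [|l1 cl1] := @real_cauchy (fun n => complex.Re (u n)).
  move=> e e0; have e0' : 0 < e%:C by rewrite ltcR.
  have [N uN] := cu _ e0'; exists N => n /uN.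
  by move/(le_trans (normRe _)); rewrite lecR; case: (u n) (u N) => [? ?] [? ?].
have [|l2 cl2] := @real_cauchy (fun n => complex.Im (u n)).
  move=> e e0; have e0' : 0 < e%:C by rewrite ltcR.
  have [N uN] := cu _ e0'; exists N => n /uN.
  by move/(le_trans (normIm _)); rewrite lecR; case: (u n) (u N) => [? ?] [? ?].
exists (l1 +i* l2) => e e0.
have /complex_realP[d dE] : e \is Num.real by rewrite gtr0_real.
move: e0; rewrite {}dE ltcR => d0.
have d2 : 0 < d / 2 by rewrite divr_gt0.
have [N1 h1] := cl1 _ d2; have [N2 h2] := cl2 _ d2.
exists (maxn N1 N2) => n; rewrite geq_max => /andP[/h1 {}h1 /h2 {}h2].
apply: le_trans (norm_le_ReIm _) _; rewrite -rmorphD lecR.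
case: (u n) h1 h2 => a b /=; lra.
Qed.
End Completeness.

(** * Uniform limits of polynomials on a disc *)

Section UniformPoly.
Variable R : realType.
Local Notation C := R[i].

(** Closure under products and uniform limits, together with the Taylor estimate below, lets this
    property stand in for holomorphy on the disc without any contour integral. *)
Definition unif_poly (r : C) (f : C -> C) : Prop :=
  forall e, 0 < e -> exists P : {poly C},
    forall w, `|w| <= r -> `|f w - P.[w]| <= e.

Lemma unif_poly_eq r f g : (forall w, `|w| <= r -> f w = g w) ->
  unif_poly r g -> unif_poly r f.
Proof.
move=> fg ug e /ug[P PE]; exists P => w wr.
by rewrite fg // PE.
Qed.

Lemma unif_poly_horner r (P : {poly C}) : unif_poly r (horner P).
Proof. by move=> e e0; exists P => w _; rewrite subrr normr0 ltW. Qed.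

Lemma poly_bounded (P : {poly C}) (r : C) : 0 <= r ->
  exists2 B, 0 < B & forall w, `|w| <= r -> `|P.[w]| <= B.
Proof.
move=> r0; elim/poly_ind: P => [|P c [B B0 PB]].
  by exists 1 => // w _; rewrite horner0 normr0 ler01.
exists (B * r + `|c| + 1) => [|w wr].
  by rewrite ltr_wpDl // addr_ge0 // mulr_ge0 // ltW.
rewrite hornerMXaddC; apply: le_trans (ler_normD _ _) _.
by rewrite -addrA lerD ?lerDl // normrM ler_pM // PB.
Qed.

Lemma unif_poly_bounded r f : 0 <= r -> unif_poly r f ->
  exists2 B, 0 < B & forall w, `|w| <= r -> `|f w| <= B.
Proof.
move=> r0 /(_ 1 ltr01)[P fP]; have [B B0 PB] := poly_bounded P r0.
exists (1 + B) => [|w wr]; first by rewrite addr_gt0.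
rewrite -[f w](subrK P.[w]); apply: le_trans (ler_normD _ _) _.
by rewrite lerD ?fP ?PB.
Qed.

Lemma unif_poly_mul r f g : 0 <= r -> unif_poly r f -> unif_poly r g ->
  unif_poly r (fun w => f w * g w).
Proof.
move=> r0 uf ug e e0; have [B B0 gB] := unif_poly_bounded r0 ug.
have [|P fP] := uf (e / 2%:R / B); first by rewrite !divr_gt0 ?ltr0n.
have [M M0 PM] := poly_bounded P r0.
have [|Q gQ] := ug (e / 2%:R / M); first by rewrite !divr_gt0 ?ltr0n.
exists (P * Q) => w wr; rewrite hornerM.
have -> : f w * g w - P.[w] * Q.[w] =
  (f w - P.[w]) * g w + P.[w] * (g w - Q.[w]) by ring.
apply: le_trans (ler_normD _ _) _; rewrite !normrM.
have -> : e = e / 2%:R / B * B + M * (e / 2%:R / M).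
  by field; rewrite !gt_eqF.
by rewrite lerD // ler_pM // ?fP ?gB ?PM ?gQ.
Qed.

(* 1/(w - b) = - b^-1 * sum_i (w/b)^i, geometric since |w| <= r < |b|. *)
Lemma unif_poly_inv_linear r b : 0 <= r -> r < `|b| ->
  unif_poly r (fun w => (w - b)^-1).
Proof.
move=> r0 rb e e0.
have b0 : 0 < `|b| by apply: le_lt_trans rb.
have bn0 : b != 0 by rewrite -normr_gt0.
have rho1 : r / `|b| < 1 by rewrite ltr_pdivrMr // mul1r.
have rho0 : 0 <= r / `|b| by rewrite divr_ge0.
have d0 : 0 < `|b| - r by rewrite subr_gt0.
have [n nE] := expr_small rho0 rho1 (mulr_gt0 e0 d0).
exists ((- b^-1) *: \sum_(i < n) (b^-1 *: 'X) ^+ i) => w wr.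
have wb : w - b != 0.
  by rewrite subr_eq0; apply: contraTneq rb => <-; rewrite le_gtF.
have -> : (w - b)^-1 - (- b^-1 *: \sum_(i < n) (b^-1 *: 'X) ^+ i).[w] =
    (w / b) ^+ n / (w - b).
  rewrite hornerZ horner_sum.
  under eq_bigr do rewrite horner_exp hornerZ hornerX.
  set x := w / b; rewrite (_ : b^-1 * w = x); last by rewrite mulrC.
  apply: (mulIf wb); rewrite mulfVK // mulrBl mulVf //.
  have -> : w - b = b * (x - 1) by rewrite /x mulrBr mulr1 mulrC mulfVK.
  rewrite -[x ^+ n](subrK 1) subrX1; set S := bigop _ _ _; move: x S => x S.
  by field.
rewrite normrM normfV normrX normrM normfV.
have wbge : `|b| - r <= `|w - b|.
  rewrite distrC; apply: le_trans (lerB_dist _ _).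
  by rewrite lerD2l lerN2.
rewrite ler_pdivrMr ?normr_gt0 //.
apply: (@le_trans _ _ (e * (`|b| - r))); last by rewrite ler_pM2l.
apply: le_trans nE; rewrite lerXn2r ?nnegrE ?divr_ge0 //.
by rewrite ler_pM2r ?invr_gt0.
Qed.

(** [Q] splits into linear factors whose roots lie outside the closed disc, so
    [unif_poly_inv_linear] applies to each factor. *)
Lemma unif_poly_rational r (P Q : {poly C}) : 0 <= r ->
  (forall w, `|w| <= r -> Q.[w] != 0) ->
  unif_poly r (fun w => P.[w] / Q.[w]).
Proof.
move=> r0 Q0; have [s sE] := closed_field_poly_normal Q.
have lc0 : lead_coef Q != 0.
  have : Q.[0] != 0 by rewrite Q0 ?normr0.
  by apply: contraNneq => lc; rewrite {1}sE lc scale0r horner0.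
have sr z : z \in s -> r < `|z|.
  move=> zs; rewrite real_ltNge ?normr_real ?ger0_real //.
  apply/negP => /Q0; rewrite sE hornerZ mulf_eq0 (negPf lc0) /=.
  by rewrite -rootE root_prod_XsubC zs.
have -> : (fun w => P.[w] / Q.[w]) =
   (fun w => P.[w] / lead_coef Q * \prod_(z <- s) (w - z)^-1).
  apply: boolp.funext => w; rewrite [in X in _ / X]sE hornerZ invfM mulrA.
  congr (_ * _); rewrite horner_prod -prodfV; apply: eq_bigr => z _.
  by rewrite hornerXsubC.
apply: unif_poly_mul => //.
  apply: (@unif_poly_eq _ _ (horner (P * (lead_coef Q)^-1%:P))).
    by move=> w _; rewrite hornerM hornerC.
  exact: unif_poly_horner.
elim: s sr {sE} => [|z s IH] sr.
  apply: (@unif_poly_eq _ _ (horner 1)) (unif_poly_horner _ _).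
  by move=> w _; rewrite big_nil hornerC.
apply: (@unif_poly_eq _ _ (fun w => (w - z)^-1 * \prod_(z <- s) (w - z)^-1)).
  by move=> w _; rewrite big_cons.
apply: unif_poly_mul => //.
  by apply: unif_poly_inv_linear; rewrite ?sr ?mem_head.
by apply: IH => t ts; rewrite sr // in_cons ts orbT.
Qed.

Lemma unif_poly_lim r f : (forall e, 0 < e -> exists2 g, unif_poly r g &
    forall w, `|w| <= r -> `|f w - g w| <= e) -> unif_poly r f.
Proof.
move=> fg e e0; have e2 : 0 < e / 2%:R by rewrite divr_gt0 ?ltr0n.
have [g ug fgE] := fg _ e2; have [P PE] := ug _ e2.
exists P => w wr; have -> : f w - P.[w] = (f w - g w) + (g w - P.[w]) by ring.
apply: le_trans (ler_normD _ _) _.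
by rewrite [e in _ <= e]splitr lerD ?fgE ?PE.
Qed.

Lemma ler_addgt0 (x y c : C) : 0 < c ->
  (forall e, 0 < e -> x <= y + c * e) -> x <= y.
Proof.
move=> c0 xy; apply/ler_addgt0Pr => e e0.
have := xy (e / c) (divr_gt0 e0 c0).
by rewrite mulrC mulfVK // gt_eqF.
Qed.

(** The Cauchy estimate for [P n - P N] makes the linear coefficients a Cauchy sequence with limit
    [l]. The quadratic remainder bound is uniform, since every [P k] is at most [M + 1] on the
    circle, and so it passes to the limit. *)
Lemma unif_poly_taylor1 r f : 0 < r -> unif_poly r f ->
  exists l, exists2 B, 0 <= B & forall h, `|h| <= r / 4%:R ->
    `|f h - f 0 - l * h| <= B * `|h| ^+ 2.
Proof.
move=> r0 uf; have r0' := ltW r0.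
have ek k : 0 < (k.+1%:R : C)^-1 by rewrite invr_gt0 ltr0n.
have [P PE] := boolp.choice (fun k => uf _ (ek k)).
have [M M0 fM] := unif_poly_bounded r0' uf.
have PM k w : `|w| = r -> `|(P k).[w]| <= M + 1.
  move=> wr; rewrite -[(P k).[w]](subrK (f w)).
  apply: le_trans (ler_normD _ _) _; rewrite addrC lerD ?fM ?wr //.
  by rewrite distrC (le_trans (PE k w _)) ?wr // invf_le1 ?ltr0n // ler1n.
have ein N n : (N <= n)%N -> (n.+1%:R : C)^-1 <= N.+1%:R^-1.
  by move=> Nn; rewrite lef_pV2 ?posrE ?ltr0n // ler_nat.
have c0 : 0 < 4%:R / r by rewrite divr_gt0 ?ltr0n.
have P1 N n : (N <= n)%N -> `|(P n)`_1 - (P N)`_1| <= 4%:R / r * N.+1%:R^-1.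
  move=> Nn; rewrite -coefB.
  (* Both polynomials are within [1/(N+1)] of [f] on the circle, which gives the bound [2/(N+1)] for
     their difference. *)
  have [] := @poly_taylor1 _ (P n - P N) r (2%:R * N.+1%:R^-1) r0.
    move=> w wr; rewrite hornerD hornerN.
    have -> : (P n).[w] - (P N).[w] = (f w - (P N).[w]) - (f w - (P n).[w]) by ring.
    apply: le_trans (ler_normB _ _) _; rewrite mulr_natl mulr2n.
    by rewrite lerD ?PE ?wr // (le_trans (PE n w _)) ?wr // ein.
  move=> + _; rewrite (_ : 2%:R * _ / r = 4%:R / r * N.+1%:R^-1) //.
  by move: (N.+1%:R^-1) => x; field; rewrite gt_eqF.
have small e : 0 < e -> exists N : nat, (N.+1%:R : C)^-1 <= e.
  move=> e0; have [N NE] := archi_complex e0 (real1 C).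
  exists N; rewrite -[_^-1]mul1r ler_pdivrMr ?ltr0n //.
  by apply: le_trans NE _; rewrite ler_pM2l // ler_nat leqnSn.
have [|l lE] := @complex_cauchy R (fun n => (P n)`_1).
  move=> e e0; have [N NE] := small _ (divr_gt0 e0 c0).
  exists N => n /P1/le_trans; apply.
  by rewrite mulrC -ler_pdivlMr.
exists l; exists (8%:R * (M + 1) / r ^+ 2) => [|h hr].
  by rewrite divr_ge0 ?exprn_ge0 // mulr_ge0 ?ler0n // addr_ge0 ?ler01 // ltW.
have hr' : `|h| <= r.
  by apply: le_trans hr _; rewrite ler_piMr // invf_le1 ?ltr0n // ler1n.
(* The error budget: one [e] each for the values at [h] and at 0, and [e |h|] for the linear
   coefficient. *)
apply: (@ler_addgt0 _ _ (2%:R + `|h|)); first by rewrite ltr_wpDr ?ltr0n.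
move=> e e0; have [N1 N1E] := lE _ e0; have [N2 N2E] := small _ e0.
pose N := maxn N1 N2.
have PeN w : `|w| <= r -> `|f w - (P N).[w]| <= e.
  move=> wr; apply: le_trans (PE N w wr) _; apply: le_trans N2E.
  by rewrite ein // leq_maxr.
have [_ /(_ h hr) TN] := poly_taylor1 r0 (PM N).
have -> : f h - f 0 - l * h = ((P N).[h] - (P N).[0] - (P N)`_1 * h) +
  ((f h - (P N).[h]) - (f 0 - (P N).[0]) + ((P N)`_1 - l) * h) by ring.
apply: le_trans (ler_normD _ _) _; apply: lerD => //.
apply: le_trans (ler_normD _ _) _; rewrite [(2%:R + _) * e]mulrDl [`|h| * e]mulrC; apply: lerD.
  apply: le_trans (ler_normB _ _) _; rewrite mulr_natl mulr2n.
  by rewrite lerD ?PeN // normr0.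
by rewrite normrM ler_wpM2r // N1E // leq_maxl.
Qed.
End UniformPoly.

(** * Complex differentiability *)

Section Differentiability.
Variable C : numFieldType.

Definition near0 (P : C -> Prop) : Prop :=
  exists2 d, 0 < d & forall h, `|h| < d -> P h.

Lemma near0_and (P Q : C -> Prop) : near0 P -> near0 Q ->
  near0 (fun h => P h /\ Q h).
Proof.
move=> [d d0 dP] [d' d'0 d'Q].
have /orP[dd|dd] := real_leVge (gtr0_real d0) (gtr0_real d'0).
  by exists d => // h hd; split; [apply: dP | apply/d'Q/(lt_le_trans hd)].
by exists d' => // h hd; split; [apply/dP/(lt_le_trans hd) | apply: d'Q].
Qed.

Lemma near0_imp (P Q : C -> Prop) : (forall h, P h -> Q h) -> near0 P -> near0 Q.
Proof. by move=> PQ [d d0 dP]; exists d => // h /dP/PQ. Qed.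

Definition tend0 (f : C -> C) := forall e, 0 < e -> near0 (fun h => `|f h| <= e).
Definition small_o (f : C -> C) :=
  forall e, 0 < e -> near0 (fun h => `|f h| <= e * `|h|).
Definition locally_bounded (f : C -> C) := exists2 M, 0 < M & near0 (fun h => `|f h| <= M).

(** The increment form avoids quotients and admits [h = 0], which keeps the chain rule free of case
    distinctions; [mdiff_holo_at] returns to the difference quotient. *)
Definition cdiff (f : C -> C) (z : C) : Prop :=
  exists l, small_o (fun h => f (z + h) - f z - l * h).

Lemma small_o_near f g : near0 (fun h => f h = g h) -> small_o g -> small_o f.
Proof.
move=> fg og e /og /(near0_and fg); apply: near0_imp.
by move=> h [->].
Qed.

Lemma small_o_eq f g : f =1 g -> small_o g -> small_o f.
Proof. by move=> fg; apply: small_o_near; exists 1. Qed.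

Lemma small_o_add f g : small_o f -> small_o g -> small_o (fun h => f h + g h).
Proof.
move=> of_ og e e0; have e2 : 0 < e / 2%:R by rewrite divr_gt0 ?ltr0n.
apply: near0_imp (near0_and (of_ _ e2) (og _ e2)) => h [fh gh].
apply: le_trans (ler_normD _ _) _.
by rewrite [e in _ <= e * _]splitr mulrDl lerD.
Qed.

Lemma small_o_mul f g : small_o f -> locally_bounded g -> small_o (fun h => f h * g h).
Proof.
move=> of_ [M M0 gM] e e0.
apply: near0_imp (near0_and (of_ _ (divr_gt0 e0 M0)) gM) => h [fh gh].
rewrite normrM (le_trans (ler_pM _ _ fh gh)) //.
by rewrite mulrAC mulfVK ?gt_eqF.
Qed.

Lemma small_o_tend0 f : tend0 f -> small_o (fun h => f h * h).
Proof.
move=> tf e /tf; apply: near0_imp => h fh.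
by rewrite normrM ler_wpM2r.
Qed.

Lemma locally_bounded_cst c : locally_bounded (fun=> c).
Proof.
exists (`|c| + 1); first by rewrite ltr_wpDl.
by exists 1 => // h _; rewrite lerDl ler01.
Qed.

Lemma locally_bounded_tend f c : tend0 (fun h => f h - c) -> locally_bounded f.
Proof.
move=> /(_ 1 ltr01) fc; exists (1 + `|c|); first by rewrite ltr_wpDr.
apply: near0_imp fc => h fh; rewrite -[f h](subrK c).
by apply: le_trans (ler_normD _ _) _; rewrite lerD2r.
Qed.

Lemma tend0_lip f M : 0 <= M -> near0 (fun h => `|f h| <= M * `|h|) -> tend0 f.
Proof.
move=> M0 fM e e0; have M1 : 0 < M + 1 by rewrite ltr_wpDl.
have : near0 (fun h => `|h| <= e / (M + 1)).
  by exists (e / (M + 1)) => [|h /ltW//]; rewrite divr_gt0.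
move/(near0_and fM); apply: near0_imp => h [fh hd].
apply: le_trans fh _; apply: (@le_trans _ _ ((M + 1) * `|h|)).
  by rewrite ler_wpM2r // lerDl.
by rewrite mulrC -ler_pdivlMr.
Qed.

Lemma cdiff_lip f z : cdiff f z ->
  exists2 M, 0 <= M & near0 (fun h => `|f (z + h) - f z| <= M * `|h|).
Proof.
move=> [l /(_ 1 ltr01) fl]; exists (1 + `|l|); first by rewrite addr_ge0.
apply: near0_imp fl => h fh; rewrite -[_ - _](subrK (l * h)).
by apply: le_trans (ler_normD _ _) _; rewrite mulrDl normrM lerD2r.
Qed.

Lemma cdiff_tend0 f z : cdiff f z -> tend0 (fun h => f (z + h) - f z).
Proof. by move=> /cdiff_lip[M M0]; apply: tend0_lip. Qed.

Lemma cdiff_eq f g z : f =1 g -> cdiff g z -> cdiff f z.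
Proof. by move=> fg [l gl]; exists l; apply: small_o_eq gl => h; rewrite !fg. Qed.

Lemma cdiff_cst c z : cdiff (fun=> c) z.
Proof.
exists 0 => e e0; exists 1 => // h _.
by rewrite subrr mul0r subrr normr0 mulr_ge0 // ltW.
Qed.

Lemma cdiff_id z : cdiff id z.
Proof.
exists 1 => e e0; exists 1 => // h _.
by rewrite mul1r [z + h]addrC addrK subrr normr0 mulr_ge0 // ltW.
Qed.

Lemma cdiff_add f g z : cdiff f z -> cdiff g z -> cdiff (fun w => f w + g w) z.
Proof.
move=> [l fl] [m gm]; exists (l + m); apply: small_o_eq (small_o_add fl gm) => h /=.
ring.
Qed.

Lemma cdiff_mul f g z : cdiff f z -> cdiff g z -> cdiff (fun w => f w * g w) z.
Proof.
move=> cf cg; have tg := cdiff_tend0 cg; move: cf cg => [l fl] [m gm].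
exists (l * g z + f z * m).
have o1 := small_o_mul fl (locally_bounded_tend tg).
have o2 := small_o_mul (small_o_tend0 tg) (locally_bounded_cst l).
have o3 := small_o_mul gm (locally_bounded_cst (f z)).
apply: small_o_eq (small_o_add o1 (small_o_add o2 o3)) => h /=; ring.
Qed.

Lemma cdiff_inv f z : cdiff f z -> f z != 0 -> cdiff (fun w => (f w)^-1) z.
Proof.
move=> cf fz; have tf := cdiff_tend0 cf; case: cf => l fl.
have fz0 : 0 < `|f z| by rewrite normr_gt0.
have nf : near0 (fun h => `|f z| / 2%:R <= `|f (z + h)|).
  apply: near0_imp (tf _ (divr_gt0 fz0 (ltr0n _ 2))) => h.
  rewrite distrC => /(le_trans (lerB_dist _ _)); rewrite lerBlDr -lerBlDl.
  by rewrite {1}[`|f z|]splitr addrK.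
have f2 : 0 < `|f z| / 2%:R by rewrite divr_gt0 ?ltr0n.
have nf0 : near0 (fun h => f (z + h) != 0).
  by apply: near0_imp nf => h /(lt_le_trans f2); rewrite normr_gt0.
have bf : locally_bounded (fun h => (f (z + h))^-1).
  exists (`|f z| / 2%:R)^-1; first by rewrite invr_gt0.
  apply: near0_imp (near0_and nf0 nf) => h [fh0 fh].
  by rewrite normfV lef_pV2 ?posrE ?normr_gt0.
exists (- l / f z ^+ 2).
have o1 := small_o_mul (small_o_mul fl bf) (locally_bounded_cst (- (f z)^-1)).
have o2 := small_o_mul (small_o_mul (small_o_tend0 tf) bf) (locally_bounded_cst (l / f z ^+ 2)).
apply: small_o_near (small_o_add o1 o2).
apply: near0_imp nf0 => h fh; field.
by rewrite fz fh.
Qed.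

Lemma cdiff_comp f g z : cdiff g z -> cdiff f (g z) -> cdiff (fun w => f (g w)) z.
Proof.
move=> cg [l fl]; have [M M0 gM] := cdiff_lip cg.
have tg := cdiff_tend0 cg; case: cg => m gm; exists (l * m).
have o2 := small_o_mul gm (locally_bounded_cst l).
have o1 : small_o (fun h => f (g z + (g (z + h) - g z)) - f (g z) - l * (g (z + h) - g z)).
  move=> e e0; have M1 : 0 < M + 1 by rewrite ltr_wpDl.
  have [d d0 fd] := fl _ (divr_gt0 e0 M1).
  have d2 : 0 < d / 2%:R by rewrite divr_gt0 ?ltr0n.
  apply: near0_imp (near0_and (tg _ d2) gM) => h [gd gh].
  have := fd (g (z + h) - g z).
  rewrite (le_lt_trans gd) ?ltr_pdivrMr ?ltr0n ?ltr_pMr ?ltr1n //.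
  move=> /(_ isT) /le_trans; apply; rewrite mulrAC ler_pdivrMr // -mulrA.
  rewrite ler_pM2l //; apply: le_trans gh _.
  by rewrite mulrC ler_wpM2l // lerDl.
apply: small_o_eq (small_o_add o1 o2) => h /=.
by rewrite [g z + _]addrC subrK; ring.
Qed.

Lemma cdiff_sum (I : Type) (s : seq I) (P : pred I) (F : I -> C -> C) z :
  (forall i, cdiff (F i) z) -> cdiff (fun w => \sum_(i <- s | P i) F i w) z.
Proof.
move=> cF; elim: s => [|i s IH].
  by apply: cdiff_eq (cdiff_cst 0 z) => w; rewrite big_nil.
case Pi: (P i); last by apply: cdiff_eq IH => w; rewrite big_cons Pi.
by apply: cdiff_eq (cdiff_add (cF i) IH) => w; rewrite big_cons Pi.
Qed.

Lemma cdiff_prod (I : Type) (s : seq I) (F : I -> C -> C) z :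
  (forall i, cdiff (F i) z) -> cdiff (fun w => \prod_(i <- s) F i w) z.
Proof.
move=> cF; elim: s => [|i s IH].
  by apply: cdiff_eq (cdiff_cst 1 z) => w; rewrite big_nil.
by apply: cdiff_eq (cdiff_mul (cF i) IH) => w; rewrite big_cons.
Qed.

Definition mdiff a b (A : C -> 'M[C]_(a, b)) z := forall i k, cdiff (fun w => A w i k) z.

Lemma mdiff_cst a b (A : 'M[C]_(a, b)) z : mdiff (fun=> A) z.
Proof. by move=> i k; apply: cdiff_cst. Qed.

Lemma mdiff_add a b (A B : C -> 'M[C]_(a, b)) z :
  mdiff A z -> mdiff B z -> mdiff (fun w => A w + B w) z.
Proof.
move=> dA dB i k; apply: cdiff_eq (cdiff_add (dA i k) (dB i k)) => w.
by rewrite mxE.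
Qed.

Lemma mdiff_scale a b (f : C -> C) (A : C -> 'M[C]_(a, b)) z :
  cdiff f z -> mdiff A z -> mdiff (fun w => f w *: A w) z.
Proof.
move=> df dA i k; apply: cdiff_eq (cdiff_mul df (dA i k)) => w.
by rewrite mxE.
Qed.

Lemma mdiff_mul a b c (A : C -> 'M[C]_(a, b)) (B : C -> 'M[C]_(b, c)) z :
  mdiff A z -> mdiff B z -> mdiff (fun w => A w *m B w) z.
Proof.
move=> dA dB i k.
have dAB l : cdiff (fun w => A w i l * B w l k) z by apply: cdiff_mul.
by apply: cdiff_eq (cdiff_sum _ _ dAB) => w; rewrite mxE.
Qed.

Lemma cdiff_det n (A : C -> 'M[C]_n) z : mdiff A z -> cdiff (fun w => \det (A w)) z.
Proof.
move=> dA; apply: cdiff_sum => s; apply: cdiff_mul; first exact: cdiff_cst.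
by apply: cdiff_prod => i; apply: dA.
Qed.

Lemma mdiff_adj n (A : C -> 'M[C]_n) z :
  mdiff A z -> mdiff (fun w => \adj (A w)) z.
Proof.
move=> dA i k.
have d1 : mdiff (fun w => row' k (col' i (A w))) z.
  by move=> s t; apply: cdiff_eq (dA _ _) => w; rewrite !mxE.
apply: cdiff_eq (cdiff_mul (cdiff_cst ((-1) ^+ (k + i)) z) (cdiff_det d1)) => w.
by rewrite mxE.
Qed.

(** The cofactor formula is a single expression at every [w], whereas [invmx] tests invertibility
    first. *)
Lemma mdiff_inv n (A : C -> 'M[C]_n) z : mdiff A z -> A z \in unitmx ->
  mdiff (fun w => (\det (A w))^-1 *: \adj (A w)) z.
Proof.
move=> dA; rewrite unitmxE unitfE => Az.
by apply: mdiff_scale (mdiff_adj dA); apply: cdiff_inv Az; apply: cdiff_det.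
Qed.
End Differentiability.

(** * Complex derivatives and the predicate [holo_at] *)

Section HoloAt.
Variable R : realType.
Local Notation C := R[i].

Lemma mdiff_holo_at a b (f : C -> 'M[C]_(a, b)) z : mdiff f z -> holo_at f z.
Proof.
move=> df i k; have [l fl] := df i k; exists l => e e0.
(* Half of [e] leaves room for the strict inequality in [holo_at]. *)
have e2 : 0 < (e / 2)%:C by rewrite ltcR divr_gt0.
have [d d0 fd] := fl _ e2.
have /complex_realP[d' dE] : d \is Num.real by rewrite gtr0_real.
move: d0 fd; rewrite dE ltcR => d0 fd; exists d'; split=> // h h0 /fd fh.
have h0' : 0 < `|h| by rewrite normr_gt0.
have -> : (f (z + h) i k - f z i k) / h - l =
   (f (z + h) i k - f z i k - l * h) / h by field.
rewrite normrM normfV ltr_pdivrMr //; apply: le_lt_trans fh _.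
by rewrite ltr_pM2r // ltcR ltr_pdivrMr // ltr_pMr // ltr1n.
Qed.

Lemma holo_at_tend0 a b (f : C -> 'M[C]_(a, b)) z : holo_at f z ->
  forall i k, tend0 (fun h => f (z + h) i k - f z i k).
Proof.
move=> hf i k; have [l /(_ 1 ltr01)[d [d0 fd]]] := hf i k.
apply: (@tend0_lip _ _ (1 + `|l|)); first by rewrite addr_ge0.
exists d%:C => [|h hd]; first by rewrite ltcR.
have [->|h0] := eqVneq h 0; first by rewrite addr0 subrr !normr0 mulr0.
have fh := ltW (fd h h0 hd).
rewrite -[_ - _](divfK h0) normrM ler_wpM2r //.
by rewrite -[_ / h](subrK l); apply: le_trans (ler_normD _ _) _; rewrite lerD2r.
Qed.
End HoloAt.

(** * Limits along filters *)

Section FilterLimits.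
Variables (R : realType) (T : Type) (F : (T -> Prop) -> Prop).
Local Notation C := R[i].
Hypothesis F_and : forall P Q, F P -> F Q -> F (fun x => P x /\ Q x).
Hypothesis F_imp : forall P Q : T -> Prop, (forall x, P x -> Q x) -> F P -> F Q.
Hypothesis F_true : F (fun=> True).
Hypothesis F_ex : forall P, F P -> exists x, P x.

(** The filter [F] is [eventually] for limits of the discs in the index, and [punctured] for limits
    in [lam] that avoid exceptional points. *)
Definition flim (f : T -> C) (l : C) : Prop :=
  forall e, 0 < e -> F (fun x => `|f x - l| <= e).

Lemma flim_cst c : flim (fun=> c) c.
Proof.
move=> e e0; apply: F_imp F_true => x _.
by rewrite subrr normr0 ltW.
Qed.

Lemma flim_add f g l m : flim f l -> flim g m -> flim (fun x => f x + g x) (l + m).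
Proof.
move=> fl gm e e0; have e2 : 0 < e / 2%:R by rewrite divr_gt0 ?ltr0n.
apply: F_imp (F_and (fl _ e2) (gm _ e2)) => x [fx gx].
rewrite opprD addrACA; apply: le_trans (ler_normD _ _) _.
by rewrite [e]splitr lerD.
Qed.

Lemma flim_opp f l : flim f l -> flim (fun x => - f x) (- l).
Proof. by move=> fl e /fl; apply: F_imp => x; rewrite -opprD normrN. Qed.

Lemma flim_mul f g l m : flim f l -> flim g m -> flim (fun x => f x * g x) (l * m).
Proof.
move=> fl gm e e0; have e2 : 0 < e / 2%:R by rewrite divr_gt0 ?ltr0n.
have m0 : 0 < `|m| + 1 by rewrite ltr_wpDl.
have l0 : 0 < `|l| + 1 by rewrite ltr_wpDl.
apply: F_imp (F_and (fl _ ltr01) (F_and (fl _ (divr_gt0 e2 m0)) (gm _ (divr_gt0 e2 l0)))).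
move=> x [f1 [fx gx]].
have -> : f x * g x - l * m = (f x - l) * m + f x * (g x - m) by ring.
apply: le_trans (ler_normD _ _) _; rewrite [e]splitr !normrM; apply: lerD.
  apply: le_trans (ler_wpM2r _ fx) _ => //.
  by rewrite mulrAC ler_pdivrMr // ler_wpM2l ?ltW // ltrDl.
rewrite mulrC; apply: (@le_trans _ _ (e / 2%:R / (`|l| + 1) * (`|l| + 1))).
  apply: ler_pM => //; rewrite -[f x](subrK l) addrC.
  by apply: le_trans (ler_normD _ _) _; rewrite lerD2l.
by rewrite mulfVK // gt_eqF.
Qed.

Lemma flim_conj f l : flim f l -> flim (fun x => Num.conj (f x)) (Num.conj l).
Proof.
move=> fl e /fl; apply: F_imp => x.
by rewrite -rmorphB norm_conjC.
Qed.

Lemma flim_sum (I : Type) (s : seq I) (f : I -> T -> C) (l : I -> C) :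
  (forall i, flim (f i) (l i)) ->
  flim (fun x => \sum_(i <- s) f i x) (\sum_(i <- s) l i).
Proof.
move=> fl e; elim: s e => [|i s IH] e e0.
  by apply: F_imp F_true => x _; rewrite !big_nil subrr normr0 ltW.
by apply: F_imp (flim_add (fl i) IH e0) => x; rewrite !big_cons.
Qed.

Lemma eps_le0 (x : C) : 0 <= x -> (forall e, 0 < e -> x <= e) -> x = 0.
Proof.
move=> x0 xe; apply/eqP; rewrite eq_le x0 andbT.
by apply/ler_addgt0Pr => e e0; rewrite add0r xe.
Qed.

Lemma flim_unique f l m : flim f l -> flim f m -> l = m.
Proof.
move=> fl fm; apply/eqP; rewrite -subr_eq0 -normr_eq0; apply/eqP.
apply: eps_le0 => // e e0; have e2 : 0 < e / 2%:R by rewrite divr_gt0 ?ltr0n.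
have [x [lx mx]] := F_ex (F_and (fl _ e2) (fm _ e2)).
have -> : l - m = (f x - m) - (f x - l) by ring.
by apply: le_trans (ler_normB _ _) _; rewrite [e]splitr lerD.
Qed.

(** In the partial order of [C], nonnegativity includes being real, so the goal is recast as
    [l = |l|]; both [f x] and its modulus approximate the respective sides. *)
Lemma flim_ge0 f l : F (fun x => 0 <= f x) -> flim f l -> 0 <= l.
Proof.
move=> f0 fl; suff -> : l = `|l| by [].
apply/eqP; rewrite -subr_eq0 -normr_eq0; apply/eqP.
apply: eps_le0 => // e e0; have e2 : 0 < e / 2%:R by rewrite divr_gt0 ?ltr0n.
have [x [fx0 fx]] := F_ex (F_and f0 (fl _ e2)).
have -> : l - `|l| = (`|f x| - `|l|) - (f x - l).
  by rewrite (ger0_norm fx0); ring.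
apply: le_trans (ler_normB _ _) _; rewrite [e]splitr lerD //.
by apply: le_trans fx; apply: ler_dist_dist.
Qed.

Definition mxlim a b (A : T -> 'M[C]_(a, b)) (L : 'M[C]_(a, b)) : Prop :=
  forall i k, flim (fun x => A x i k) (L i k).

Lemma mxlim_cst a b (L : 'M[C]_(a, b)) : mxlim (fun=> L) L.
Proof. by move=> i k; apply: flim_cst. Qed.

Lemma flim_eq f g l : f =1 g -> flim g l -> flim f l.
Proof. by move=> fg gl e /gl; apply: F_imp => x; rewrite fg. Qed.

Lemma mxlim_add a b (A B : T -> 'M[C]_(a, b)) L M :
  mxlim A L -> mxlim B M -> mxlim (fun x => A x + B x) (L + M).
Proof.
move=> AL BM i k; rewrite mxE; apply: flim_eq (flim_add (AL i k) (BM i k)) => x.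
by rewrite mxE.
Qed.

Lemma mxlim_scale a b (f : T -> C) l (A : T -> 'M[C]_(a, b)) L :
  flim f l -> mxlim A L -> mxlim (fun x => f x *: A x) (l *: L).
Proof.
move=> fl AL i k; rewrite mxE; apply: flim_eq (flim_mul fl (AL i k)) => x.
by rewrite mxE.
Qed.

Lemma mxlim_opp a b (A : T -> 'M[C]_(a, b)) L : mxlim A L -> mxlim (fun x => - A x) (- L).
Proof.
move=> AL i k; rewrite mxE => e /(AL i k); apply: F_imp => x.
by rewrite mxE -opprD normrN.
Qed.

Lemma mxlim_mul a b c (A : T -> 'M[C]_(a, b)) (B : T -> 'M[C]_(b, c)) L M :
  mxlim A L -> mxlim B M -> mxlim (fun x => A x *m B x) (L *m M).
Proof.
move=> AL BM i k; rewrite mxE.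
have AB s := flim_mul (AL i s) (BM s k).
by apply: flim_eq (flim_sum (index_enum _) AB) => x; rewrite mxE.
Qed.

Lemma mxlim_col a1 a2 b (A : T -> 'M[C]_(a1, b)) (B : T -> 'M[C]_(a2, b)) L M :
  mxlim A L -> mxlim B M -> mxlim (fun x => col_mx (A x) (B x)) (col_mx L M).
Proof.
move=> AL BM i k; case: (split_ordP i) => s ->.
  by rewrite col_mxEu; apply: flim_eq (AL s k) => x; rewrite col_mxEu.
by rewrite col_mxEd; apply: flim_eq (BM s k) => x; rewrite col_mxEd.
Qed.

Lemma mxlim_usub a1 a2 b (A : T -> 'M[C]_(a1 + a2, b)) L :
  mxlim A L -> mxlim (fun x => usubmx (A x)) (usubmx L).
Proof.
move=> AL i k; rewrite mxE; apply: flim_eq (AL _ k) => x.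
by rewrite mxE.
Qed.

Lemma mxlim_dsub a1 a2 b (A : T -> 'M[C]_(a1 + a2, b)) L :
  mxlim A L -> mxlim (fun x => dsubmx (A x)) (dsubmx L).
Proof.
move=> AL i k; rewrite mxE; apply: flim_eq (AL _ k) => x.
by rewrite mxE.
Qed.

Lemma mxlim_adj a b (A : T -> 'M[C]_(a, b)) L :
  mxlim A L -> mxlim (fun x => adjmx (A x)) (adjmx L).
Proof.
move=> AL i k; rewrite !mxE; apply: flim_eq (flim_conj (AL k i)) => x.
by rewrite !mxE.
Qed.

Lemma flim_form n (A : 'M[C]_n) (v : T -> 'cV[C]_n) w :
  mxlim v w -> flim (fun x => form A (v x)) (form A w).
Proof.
move=> vw.
exact: (mxlim_mul (mxlim_mul (mxlim_adj vw) (mxlim_cst A)) vw 0 0).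
Qed.

Lemma mxlim_unique a b (A : T -> 'M[C]_(a, b)) L M : mxlim A L -> mxlim A M -> L = M.
Proof. by move=> AL AM; apply/matrixP => i k; apply: flim_unique (AL i k) (AM i k). Qed.
End FilterLimits.

(** * Linear fractional action of the products on contractions *)

Section WeylLimit.
Variables (R : realType) (p : nat) (beta : nat -> 'M[R[i]]_(p, p + p)).
Hypothesis hbeta : forall k, beta k *m Jmx R p *m adjmx (beta k) = 1%:M.
Local Notation C := R[i].
Local Notation j := (jmx R p).
Local Notation PT := (prodT beta).

Definition contr (th : 'M[C]_p) : Prop := forall u : 'cV[C]_p, sqn (th *m u) <= sqn u.

Lemma contr0 : contr 0.
Proof. by move=> u; rewrite mul0mx sqn0 sqn_ge0. Qed.

Lemma contr_form th u : contr th -> form j (col_mx (th *m u) u) <= 0.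
Proof. by move=> cth; rewrite form_col subr_le0. Qed.

(** Numerator and denominator of the linear fractional map of [prodT]: the image of the graph of
    [th] in homogeneous coordinates. *)
Definition mobius_num a n m th : 'M[C]_p := usubmx (PT a n m *m col_mx th 1%:M).
Definition mobius_den a n m th : 'M[C]_p := dsubmx (PT a n m *m col_mx th 1%:M).
Definition mobius a n m th : 'M[C]_p := mobius_num a n m th *m invmx (mobius_den a n m th).

Lemma mobius_num_den a n m th : PT a n m *m col_mx th 1%:M = col_mx (mobius_num a n m th) (mobius_den a n m th).
Proof. by rewrite vsubmxK. Qed.

Lemma mobius_num_den_mul a n m th (u : 'cV[C]_p) :
  PT a n m *m col_mx (th *m u) u = col_mx (mobius_num a n m th *m u) (mobius_den a n m th *m u).
Proof. by rewrite -mul_col_mx -mobius_num_den -mulmxA mul_col_mx mul1mx. Qed.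

Variable a : C.
Hypothesis ha : a + Num.conj a < 0.

Lemma col_neq0 (x u : 'cV[C]_p) : u != 0 -> col_mx x u != 0.
Proof.
by apply: contraNneq => xu0; rewrite -[u](col_mxKd x) xu0 linear0.
Qed.

(** A kernel vector [u] would send the nonzero cone vector [(th u; u)] to some [(x; 0)]. The image
    is nonzero and has nonpositive j-form, while [(x; 0)] has j-form [|x|^2]. *)
Lemma mobius_den_unit n m th : contr th -> mobius_den a n m th \in unitmx.
Proof.
move=> cth; apply: unitmx_ker => u bu; apply/eqP; apply/negPn/negP => u0.
have [] := prodT_le0 hbeta ha n m (col_neq0 (th *m u) u0) (contr_form u cth).
rewrite mobius_num_den_mul bu form_col sqn0 subr0 => + le0.
have /eqP -> : mobius_num a n m th *m u == 0 by rewrite -sqn_eq0 eq_le le0 sqn_ge0.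
by rewrite col_mx0 eqxx.
Qed.

Lemma mobius_col n m th : contr th ->
  PT a n m *m col_mx th 1%:M = col_mx (mobius a n m th) 1%:M *m mobius_den a n m th.
Proof.
move=> cth; rewrite mobius_num_den mul_col_mx mul1mx /mobius mulmxKV //.
exact: mobius_den_unit.
Qed.

(** Exhibits a vector of the graph of [mobius a n m th] as the image of a cone vector, so that the
    cone estimates for [prodT] apply to it. *)
Lemma mobius_colV n m th (u : 'cV[C]_p) : contr th ->
  col_mx (mobius a n m th *m u) u =
  PT a n m *m col_mx (th *m (invmx (mobius_den a n m th) *m u)) (invmx (mobius_den a n m th) *m u).
Proof.
move=> cth; rewrite mobius_num_den_mul mulmxA.
by rewrite (mulmxA (mobius_den a n m th)) mulmxV ?mobius_den_unit // mul1mx.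
Qed.

Lemma mobius_eq n m th T B : contr th ->
  PT a n m *m col_mx th 1%:M = col_mx T 1%:M *m B -> T = mobius a n m th.
Proof.
move=> cth; rewrite mobius_num_den mul_col_mx mul1mx => /eq_col_mx[tE bE].
by rewrite /mobius tE -bE mulmxK // mobius_den_unit.
Qed.

Lemma mobius_contr n m th : contr th -> contr (mobius a n m th).
Proof.
move=> cth u; rewrite -subr_le0 -form_col mobius_colV //.
set w := invmx _ *m u; have [->|w0] := eqVneq w 0.
  by rewrite mulmx0 col_mx0 mulmx0 form0.
by have [] := prodT_le0 hbeta ha n m (col_neq0 (th *m w) w0) (contr_form w cth).
Qed.

Lemma mobius_contr_lt n m th u : contr th -> u != 0 ->
  sqn (mobius a n m.+1 th *m u) < sqn u.
Proof.
move=> cth u0; rewrite -subr_lt0 -form_col mobius_colV //.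
apply: prodT_lt0 => //; last exact: contr_form.
apply: col_neq0; apply: contraNneq u0 => w0.
by rewrite -[u](mulKVmx (mobius_den_unit n m.+1 cth)) w0 mulmx0.
Qed.

Lemma mobius_mob n m l th : contr th ->
  mobius a n (m + l) th = mobius a n m (mobius a (n + m) l th).
Proof.
move=> cth; have cth' := mobius_contr (n + m) l cth; apply/esym.
apply: (@mobius_eq _ _ _ _ (mobius_den a n m (mobius a (n + m) l th) *m mobius_den a (n + m) l th)) => //.
by rewrite prodT_add -mulmxA mobius_col // mulmxA mobius_col // mulmxA.
Qed.

Local Notation q := (1 + `|a| ^+ 2).
Local Notation c := (- (a + Num.conj a)).

(** [prodT_diam] is applied to the vectors [(y1 x; x)] and [(y2 x; x)]: their difference has zero
    lower block, and each j-form is at least [- |x|^2]. *)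
Lemma mobius_dist n m th1 th2 (x : 'cV[C]_p) y1 y2 : contr th1 ->
    y1 = mobius a n m th1 -> contr th2 -> y2 = mobius a n m th2 ->
  c * m%:R * sqn ((y1 - y2) *m x) <= 4%:R * q * sqn x.
Proof.
move=> c1 y1E c2 y2E.
have V1 := mobius_colV n m x c1; have V2 := mobius_colV n m x c2.
rewrite -y1E in V1; rewrite -y2E in V2.
have E : col_mx (y1 *m x) x - col_mx (y2 *m x) x = col_mx ((y1 - y2) *m x) 0.
  by rewrite mulmxBl opp_col_mx add_col_mx subrr.
have := prodT_diam hbeta ha V1 V2 (contr_form _ c1) (contr_form _ c2).
rewrite E form_col sqn0 subr0 => /(_ (sqn_ge0 _)) /le_trans; apply.
rewrite -subr_ge0 !form_col.
set s1 := sqn (y1 *m x); set s2 := sqn (y2 *m x); set s := sqn x.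
have -> : 4%:R * q * s - - (2%:R * q * (s1 - s + (s2 - s))) = 2%:R * q * (s1 + s2).
  by move: (`|a| ^+ 2) s1 s2 s => t s1 s2 s; ring.
by rewrite mulr_ge0 ?addr_ge0 ?sqn_ge0 // mulr_ge0 ?ler0n // addr_ge0 ?exprn_ge0.
Qed.

Lemma mobius_dist_entry n m th1 th2 i k : contr th1 -> contr th2 ->
  c * m%:R * `|mobius a n m th1 i k - mobius a n m th2 i k| ^+ 2 <= 4%:R * q.
Proof.
move=> c1 c2; have := mobius_dist (delta_mx k 0) c1 (erefl (mobius a n m th1)) c2 (erefl (mobius a n m th2)).
have -> : sqn (delta_mx k 0) = 1 :> C.
  rewrite /sqn (bigD1 k) //= big1 ?addr0; last first.
    by move=> l /negPf lk; rewrite mxE lk normr0 expr0n.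
  by rewrite mxE !eqxx normr1 expr1n.
rewrite mulr1; apply: le_trans; rewrite ler_wpM2l //.
  by rewrite mulr_ge0 ?ler0n // oppr_ge0 ltW.
move: (mobius a n m th1) (mobius a n m th2) => y1 y2.
by have := ler_sqn (col k (y1 - y2)) i; rewrite -colE !mxE.
Qed.

Lemma dist_small (m : nat) (x : C) e : 0 <= x -> 0 < e ->
  4%:R * q / c / e ^+ 2 < m%:R -> c * m%:R * x ^+ 2 <= 4%:R * q -> x <= e.
Proof.
have c0 : 0 < c by rewrite oppr_gt0.
have q0 : 0 < q by rewrite ltr_wpDr ?exprn_ge0.
move=> x0 e0 me xm; rewrite -(@ler_pXn2r _ 2) ?nnegrE ?(ltW e0) //.
have m0 : 0 < (m%:R : C).
  by apply: le_lt_trans me; rewrite !divr_ge0 ?mulr_ge0 ?ler0n ?exprn_ge0 // ltW.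
rewrite -(ler_pM2l (mulr_gt0 c0 m0)); apply: le_trans xm _.
move: me; rewrite ltr_pdivrMr ?exprn_gt0 // ltr_pdivrMr // => /ltW.
by rewrite [_ * c]mulrC mulrA.
Qed.
End WeylLimit.

(** * The limit point *)

Definition eventually (P : nat -> Prop) := exists N, forall m, (N <= m)%N -> P m.

Lemma eventually_and P Q : eventually P -> eventually Q ->
  eventually (fun m => P m /\ Q m).
Proof.
move=> [N NP] [M MQ]; exists (maxn N M) => m.
by rewrite geq_max => /andP[/NP ? /MQ ?].
Qed.

Lemma eventually_imp (P Q : nat -> Prop) : (forall m, P m -> Q m) ->
  eventually P -> eventually Q.
Proof. by move=> PQ [N NP]; exists N => m /NP/PQ. Qed.

Lemma eventually_true : eventually (fun=> True). Proof. by exists 0%N. Qed.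

Lemma eventually_ex P : eventually P -> exists m, P m.
Proof. by move=> [N NP]; exists N; apply: NP. Qed.

Section WeylFunction.
Variables (R : realType) (p : nat) (beta : nat -> 'M[R[i]]_(p, p + p)).
Hypothesis hbeta : forall k, beta k *m Jmx R p *m adjmx (beta k) = 1%:M.
Local Notation C := R[i].
Local Notation j := (jmx R p).
Local Notation PT := (prodT beta).
Local Notation mob := (mobius beta).
Local Notation q a := (1 + `|a| ^+ 2).
Local Notation c a := (- (a + Num.conj a)).

Lemma archi_lt (x : C) : x \is Num.real -> exists m : nat, x < m%:R.
Proof.
move=> xr; have [n nE] := archi_complex ltr01 xr; exists n.+1.
by apply: le_lt_trans nE _; rewrite mul1r ltr_nat.
Qed.

(** For [m >= N], the image of 0 after [m] factors is also the image, under the first [N] factors,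
    of another contraction; the diameter estimate for [N] factors bounds all later differences. *)
Lemma mobius_cauchy a n : a + Num.conj a < 0 ->
  exists L, mxlim eventually (fun m => mob a n m 0) L.
Proof.
move=> ha; have c0 : 0 < c a by rewrite oppr_gt0.
have H (ik : 'I_p * 'I_p) : exists l : C,
    flim eventually (fun m => mob a n m 0 ik.1 ik.2) l.
  apply: complex_cauchy => e e0.
  have [|N NE] := @archi_lt (4%:R * q a / c a / e ^+ 2).
    have q0 : 0 < q a by rewrite ltr_wpDr ?exprn_ge0.
    apply: gtr0_real; apply: divr_gt0; last exact: exprn_gt0.
    by apply: divr_gt0 => //; apply: mulr_gt0 => //; rewrite ltr0n.
  exists N => m Nm; apply: (dist_small ha) NE _ => //.
  rewrite -(subnKC Nm) (mobius_mob hbeta ha) //; last exact: contr0.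
  apply: mobius_dist_entry => //; first by apply: mobius_contr => //; apply: contr0.
  exact: contr0.
have [L LE] := boolp.choice H.
exists (\matrix_(i, k) L (i, k)) => i k; rewrite mxE; exact: LE (i, k).
Qed.

Lemma weyl_limit : exists th : C -> nat -> 'M[C]_p, forall a n,
  a + Num.conj a < 0 -> mxlim eventually (fun m => mob a n m 0) (th a n).
Proof.
have H (an : C * nat) : exists L : 'M[C]_p, an.1 + Num.conj an.1 < 0 ->
    mxlim eventually (fun m => mob an.1 an.2 m 0) L.
  (* Outside the half-plane the limit gets the arbitrary value 0, so that choice yields a total
     function. *)
  case: (boolP (an.1 + Num.conj an.1 < 0)) => [ha|_]; last by exists 0.
  by have [L LE] := mobius_cauchy an.2 ha; exists L.
have [th thE] := boolp.choice H.
by exists (fun a n => th (a, n)) => a n; apply: thE (a, n).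
Qed.

Variable th : C -> nat -> 'M[C]_p.
Hypothesis hth : forall a n,
  a + Num.conj a < 0 -> mxlim eventually (fun m => mob a n m 0) (th a n).

Let ev_and := eventually_and.
Let ev_imp := eventually_imp.
Let ev_true := eventually_true.
Let ev_ex := eventually_ex.

Section Fixed.
Variable a : C.
Hypothesis ha : a + Num.conj a < 0.

Lemma th_contr n : contr (th a n).
Proof.
move=> u; rewrite -subr_ge0.
have L : flim eventually (fun m => sqn u + form (- 1%:M) (mob a n m 0 *m u))
    (sqn u + form (- 1%:M) (th a n *m u)).
  apply: flim_add => //; first exact: flim_cst.
  apply: flim_form => //; apply: mxlim_mul => //; first exact: hth.
  exact: mxlim_cst.
rewrite formN form1 in L; apply: flim_ge0 L => //.
exists 0%N => m _; rewrite formN form1 subr_ge0.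
by apply: mobius_contr => //; apply: contr0.
Qed.

(** The relation [mobius_num = mobius * mobius_den] for [m + l] factors is polynomial in the inner
    contraction and the outer value, so it survives [l] tending to infinity; the limiting
    denominator is invertible because [th a (n + m)] is a contraction. *)
Lemma th_mobius n m : th a n = mob a n m (th a (n + m)).
Proof.
have Z l : contr (mob a (n + m) l 0) by apply: mobius_contr => //; apply: contr0.
have L : mxlim eventually
    (fun l => PT a n m *m col_mx (mob a (n + m) l 0) 1%:M)
    (PT a n m *m col_mx (th a (n + m)) 1%:M).
  apply: mxlim_mul => //; first exact: mxlim_cst.
  apply: mxlim_col => //; first exact: hth.
  exact: mxlim_cst.
have LT := mxlim_usub ev_imp L; have LB := mxlim_dsub ev_imp L.
have LS : mxlim eventually (fun l => mob a n (m + l) 0) (th a n).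
  move=> i k e e0; have [N NE] := hth n ha i k e0.
  by exists N => l Nl; apply: NE; rewrite (leq_trans Nl) // leq_addl.
have E : mobius_num beta a n m (th a (n + m)) = th a n *m mobius_den beta a n m (th a (n + m)).
  apply: (mxlim_unique ev_and ev_ex LT).
  have LSB := mxlim_mul ev_and ev_imp ev_true LS LB.
  move=> i k; apply: flim_eq (LSB i k) => // l; congr (fun_of_matrix _ i k).
  rewrite (mobius_mob hbeta ha) //; last exact: contr0.
  by apply/esym/mulmxKV/mobius_den_unit.
by rewrite /mobius E mulmxK // mobius_den_unit //; apply: th_contr.
Qed.

Lemma th_lt n u : u != 0 -> sqn (th a n *m u) < sqn u.
Proof.
by move=> u0; rewrite (th_mobius n 1) mobius_contr_lt //; apply: th_contr.
Qed.

(** One more transfer step makes [th a n] a strict contraction, so it fixes no nonzero vector; this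
    is what makes the Cayley transform defined. *)
Lemma th_sub1_unit n : th a n - 1%:M \in unitmx.
Proof.
apply: unitmx_ker => u; rewrite mulmxBl mul1mx => /eqP; rewrite subr_eq0 => /eqP uE.
by apply/eqP/negPn/negP => /(th_lt n); rewrite uE ltxx.
Qed.
End Fixed.

(** * Rational approximants and holomorphy in the parameter [a] *)

Fixpoint prodT_poly (n m : nat) : 'M[{poly C}]_(p + p) :=
  if m is m'.+1 then
    prodT_poly n m' *m (1%:M + 'X *: map_mx polyC (Cmx beta (n + m') *m j))
  else 1%:M.

Lemma prodT_polyE a n m : map_mx (horner_eval a) (prodT_poly n m) = PT a n m.
Proof.
elim: m => [|m IH] /=; first by rewrite map_mx1.
rewrite map_mxM IH map_mxD map_mx1 map_mxZ; congr (_ *m (_ + _)).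
move: (Cmx beta _ *m j) => A; apply/matrixP => i k.
by rewrite !mxE /= /horner_eval hornerX hornerC.
Qed.

(** The inverse is written with cofactors over the polynomial ring. The common denominator evaluates
    to the determinant of an invertible [mobius_den], so it has no zero in the half-plane. *)
Lemma mobius_rational n m : exists (P : 'M[{poly C}]_p) (Q : {poly C}),
  forall a, a + Num.conj a < 0 -> Q.[a] != 0 /\
    forall i k, mob a n m 0 i k = (P i k).[a] / Q.[a].
Proof.
pose V := prodT_poly n m *m col_mx 0 1%:M.
exists (usubmx V *m \adj (dsubmx V)), (\det (dsubmx V)) => a ha.
have VE : map_mx (horner_eval a) V = PT a n m *m col_mx 0 1%:M.
  by rewrite map_mxM prodT_polyE map_col_mx map_mx0 map_mx1.
have tE : map_mx (horner_eval a) (usubmx V) = mobius_num beta a n m 0.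
  by rewrite map_usubmx VE.
have bE : map_mx (horner_eval a) (dsubmx V) = mobius_den beta a n m 0.
  by rewrite map_dsubmx VE.
have bu : mobius_den beta a n m 0 \in unitmx by apply: mobius_den_unit => //; apply: contr0.
have dE : (\det (dsubmx V)).[a] = \det (mobius_den beta a n m 0).
  by rewrite -bE det_map_mx.
split=> [|i k]; first by rewrite dE -unitfE -unitmxE.
rewrite dE /mobius /invmx bu -scalemxAr mxE mulrC; congr (_ * _).
by rewrite -tE -bE -map_mx_adj -map_mxM mxE.
Qed.

Lemma re2_le (w : C) : w + Num.conj w <= 2%:R * `|w|.
Proof.
have wr : w + Num.conj w \is Num.real by rewrite CrealE rmorphD /= conjCK addrC.
apply: le_trans (real_ler_norm wr) _; apply: le_trans (ler_normD _ _) _.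
by rewrite norm_conjC mulr_natl mulr2n.
Qed.

(** The constants of the diameter estimate are bounded uniformly on a small disc around [a0], so the
    rational approximants converge uniformly there. *)
Lemma th_diff a0 n : a0 + Num.conj a0 < 0 -> mdiff (fun a => th a n) a0.
Proof.
(* A shift of modulus at most [c a0 / 4] changes [c] by at most [c a0 / 2], which keeps the whole
   disc inside the half-plane. *)
move=> ha0 i k; pose r := c a0 / 4%:R.
have c0 : 0 < c a0 by rewrite oppr_gt0.
have r0 : 0 < r by rewrite divr_gt0 ?ltr0n.
have re2 w : `|w| <= r -> c a0 / 2%:R <= c (a0 + w).
  move=> wr; have -> : c (a0 + w) = c a0 - (w + Num.conj w).
    by rewrite rmorphD /= addrACA opprD.
  have -> : c a0 / 2%:R = c a0 - 2%:R * r by rewrite /r; field.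
  rewrite lerD2l lerN2; apply: le_trans (re2_le w) _.
  by rewrite ler_pM2l ?ltr0n.
have haw w : `|w| <= r -> (a0 + w) + Num.conj (a0 + w) < 0.
  by move=> /re2; rewrite -oppr_gt0; apply: lt_le_trans; rewrite divr_gt0 ?ltr0n.
pose q0 := 1 + (`|a0| + r) ^+ 2.
have qw w : `|w| <= r -> q (a0 + w) <= q0.
  move=> wr; rewrite lerD2l lerXn2r ?nnegrE ?addr_ge0 ?(ltW r0) //.
  by apply: le_trans (ler_normD _ _) _; rewrite lerD2l.
have q00 : 0 < q0 by rewrite ltr_wpDr // exprn_ge0 // addr_ge0 // ltW.
have uth : unif_poly r (fun w => th (a0 + w) n i k).
  apply: unif_poly_lim => e e0.
  have [|m mE] := @archi_lt (4%:R * q0 / (c a0 / 2%:R) / e ^+ 2).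
    apply: gtr0_real; apply: divr_gt0; last exact: exprn_gt0.
    by apply: divr_gt0; [apply: mulr_gt0 | apply: divr_gt0]; rewrite // ltr0n.
  exists (fun w => mob (a0 + w) n m 0 i k).
    have [P [Q PQ]] := mobius_rational n m.
    have sh (A : {poly C}) w : (A \Po ('X + a0%:P)).[w] = A.[a0 + w].
      by rewrite horner_comp hornerD hornerX hornerC addrC.
    apply: (@unif_poly_eq _ _ _
      (fun w => (P i k \Po ('X + a0%:P)).[w] / (Q \Po ('X + a0%:P)).[w])).
      by move=> w /haw/PQ[_ ->]; rewrite !sh.
    by apply: unif_poly_rational => [|w /haw/PQ[]]; rewrite ?sh // ltW.
  move=> w wr; have ha := haw w wr.
  apply: (dist_small (m := m) ha (normr_ge0 _) e0).
    apply: le_lt_trans mE; rewrite ler_pM2r ?invr_gt0 ?exprn_gt0 //.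
    apply: ler_pM; rewrite ?mulr_ge0 ?invr_ge0 ?ler0n ?addr_ge0 ?exprn_ge0 //.
    - by rewrite ltW // oppr_gt0.
    - by rewrite ler_pM2l ?ltr0n // qw.
    - by rewrite lef_pV2 ?posrE ?re2 // ?divr_gt0 ?ltr0n // oppr_gt0.
  (* The limit is itself the image of a contraction under the first [m] factors, so it is compared
     directly with the image of 0. *)
  rewrite (th_mobius ha n m); apply: mobius_dist_entry => //; first exact: th_contr.
  exact: contr0.
have [l [B B0 lB]] := unif_poly_taylor1 r0 uth.
exists l; apply: (@small_o_near _ _ (fun h => th (a0 + h) n i k - th a0 n i k - l * h)).
  by exists 1.
move=> e e0; have r4 : 0 < r / 4%:R by rewrite divr_gt0 ?ltr0n.
have n1 : near0 (fun h : C => `|h| <= r / 4%:R) by exists (r / 4%:R) => // h /ltW.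
have n2 : near0 (fun h : C => B * `|h| <= e).
  have B1 : 0 < B + 1 by rewrite ltr_wpDl.
  exists (e / (B + 1)) => [|h]; first by rewrite divr_gt0.
  rewrite ltr_pdivlMr // => /ltW; apply: le_trans.
  by rewrite mulrC ler_wpM2l // lerDl.
apply: near0_imp (near0_and n1 n2) => h [/lB lh Bh].
rewrite addr0 in lh; apply: le_trans lh _.
by rewrite expr2 mulrA ler_wpM2r.
Qed.
End WeylFunction.

(** * The Weyl function *)

Section HalfPlane.
Variable R : realType.
Local Notation C := R[i].

Lemma double_Im (z : C) : 2%:R * 'Im z = - ('i * z + Num.conj ('i * z)).
Proof.
rewrite rmorphM /= conjCi ImE mulrC mulfVK ?pnatr_eq0 //.
by rewrite mulrBr mulNr opprD opprK addrC.
Qed.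

Lemma lowerHP_neq0 (z : C) : lowerHP z -> z != 0.
Proof. by apply: contraTneq => ->; rewrite /lowerHP raddf0 ltxx. Qed.

(** Twice the real part of [i/z] equals [2 Im z / |z|^2]. *)
Lemma lowerHP_re_lt0 (z : C) : lowerHP z -> 'i / z + Num.conj ('i / z) < 0.
Proof.
move=> hz; have z0 := lowerHP_neq0 hz.
have z0' : Num.conj z != 0 by rewrite conjC_eq0.
suff -> : 'i / z + Num.conj ('i / z) = 2%:R * 'Im z / `|z| ^+ 2.
  rewrite pmulr_llt0 ?invr_gt0 ?exprn_gt0 ?normr_gt0 //.
  by rewrite pmulr_rlt0 ?ltr0n.
rewrite double_Im normCK !rmorphM fmorphV /= conjCi.
by field; rewrite z0 z0'.
Qed.

Lemma lowerHP_near (z : C) : lowerHP z -> near0 (fun h => lowerHP (z + h)).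
Proof.
move=> hz; have z0 : 0 < - 'Im z by rewrite oppr_gt0.
have two0 : 0 < 2%:R :> C by rewrite ltr0n.
exists (- 'Im z) => // h hh; rewrite /lowerHP raddfD addrC -ltrBrDr sub0r.
apply: le_lt_trans hh; rewrite -(ler_pM2l two0) double_Im.
have := re2_le (- ('i * h)).
by rewrite rmorphN /= -opprD normrN normrM normCi mul1r.
Qed.

Lemma cdiff_inv_lower (z : C) : lowerHP z -> cdiff (fun w => 'i / w) z.
Proof.
move=> /lowerHP_neq0 z0; apply: cdiff_mul; first exact: cdiff_cst.
by apply: cdiff_inv z0; apply: cdiff_id.
Qed.
End HalfPlane.

(** * Punctured neighbourhoods as a filter *)

Definition punctured (C : numFieldType) (P : C -> Prop) : Prop :=
  near0 (fun h => h != 0 -> P h).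

Section Punctured.
Variable C : numFieldType.

Lemma punctured_and (P Q : C -> Prop) : punctured P -> punctured Q ->
  punctured (fun h => P h /\ Q h).
Proof.
move=> pP pQ; apply: near0_imp (near0_and pP pQ) => h [hP hQ] h0.
by split; [apply: hP | apply: hQ].
Qed.

Lemma punctured_imp (P Q : C -> Prop) : (forall h, P h -> Q h) ->
  punctured P -> punctured Q.
Proof. by move=> PQ; apply: near0_imp => h hP /hP/PQ. Qed.

Lemma punctured_true : punctured (fun _ : C => True).
Proof. by exists 1. Qed.

Lemma punctured_ex (P : C -> Prop) : punctured P -> exists h, P h.
Proof.
move=> [d d0 dP]; have d2 : 0 < d / 2%:R by rewrite divr_gt0 ?ltr0n.
exists (d / 2%:R); apply: dP; last by rewrite gt_eqF.
by rewrite gtr0_norm // ltr_pdivrMr ?ltr0n // ltr_pMr // ltr1n.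
Qed.

Lemma near0_punctured (P : C -> Prop) : near0 P -> punctured P.
Proof. exact: near0_imp. Qed.
End Punctured.

(** * The common function of all the discs and its uniqueness *)

Section WeylDisc.
Variables (R : realType) (p : nat) (beta : nat -> 'M[R[i]]_(p, p + p)).
Hypothesis hbeta : forall k, beta k *m Jmx R p *m adjmx (beta k) = 1%:M.
Local Notation C := R[i].
Local Notation j := (jmx R p).
Local Notation K := (Kmx R p).
Variable th : C -> nat -> 'M[C]_p.
Hypothesis hth : forall a n, a + Num.conj a < 0 ->
  mxlim eventually (fun m => mobius beta a n m 0) (th a n).

(** The Cayley transform induced by [K], since [K (th; 1) = s (th - 1; th + 1)]. The inverse is
    spelled out with cofactors so that [mdiff_inv] applies. *)
Definition weyl_fun (lam : C) : 'M[C]_p :=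
  let A := th ('i / lam) 0 - 1%:M in
  'i *: ((th ('i / lam) 0 + 1%:M) *m ((\det A)^-1 *: \adj A)).

Lemma submx_col (M : 'M[C]_(p + p)) (X Y : 'M[C]_p) :
  (ulsubmx M *m X + ursubmx M *m Y = usubmx (M *m col_mx X Y)) *
  (dlsubmx M *m X + drsubmx M *m Y = dsubmx (M *m col_mx X Y)).
Proof.
by rewrite -{3 6}[M]submxK mul_block_col col_mxKu col_mxKd.
Qed.

Lemma th_mdiff n lam : lowerHP lam -> mdiff (fun w => th ('i / w) n) lam.
Proof.
move=> hl i k; have ha := lowerHP_re_lt0 hl.
exact: (cdiff_comp (cdiff_inv_lower hl) (th_diff hbeta hth n ha i k)).
Qed.

Lemma weyl_fun_mdiff lam : lowerHP lam -> mdiff weyl_fun lam.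
Proof.
move=> hl; have ha := lowerHP_re_lt0 hl.
have d := th_mdiff 0 hl.
apply: mdiff_scale; first exact: cdiff_cst.
apply: mdiff_mul; first by apply: mdiff_add d (mdiff_cst _ _).
apply: mdiff_inv; first by apply: mdiff_add d (mdiff_cst _ _).
exact: th_sub1_unit.
Qed.

Lemma weyl_funE lam : lowerHP lam -> weyl_fun lam =
  'i *: ((th ('i / lam) 0 + 1%:M) *m invmx (th ('i / lam) 0 - 1%:M)).
Proof.
move=> /lowerHP_re_lt0 ha; rewrite /weyl_fun /invmx.
by rewrite (th_sub1_unit hbeta hth ha).
Qed.

Lemma meromorphic_mdiff (f : C -> 'M[C]_p) :
  (forall lam, lowerHP lam -> mdiff f lam) ->
  meromorphic_lowerHP (fun=> False) f.
Proof.
move=> df; split=> // [z _|z /df dz _]; first by exists 1; rewrite ltr01.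
exact: mdiff_holo_at.
Qed.

Let s : C := ((Num.sqrt (2 : R))^-1)%:C.

Let s_neq0 : s != 0.
Proof.
by rewrite fmorph_eq0 invr_eq0 sqrtr_eq0 -ltNge ltr0n.
Qed.

(** The parameters [R = th_(N+1)] and [Q = 1] are defined on the whole half-plane, so both
    exceptional sets are empty; [th_mobius] with [N + 1] factors recovers [th_0]. *)
Lemma weyl_fun_disc N : weyl_disc beta N weyl_fun.
Proof.
split; first by move=> z /weyl_fun_mdiff; apply: mdiff_holo_at.
exists (fun lam => th ('i / lam) N.+1), (fun=> 1%:M), (fun=> False); split.
- by apply: meromorphic_mdiff => lam; apply: th_mdiff.
- by apply: meromorphic_mdiff => lam _; apply: mdiff_cst.
- by [].
- move=> lam hl _; have ha := lowerHP_re_lt0 hl.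
  have cth := th_contr hbeta hth ha N.+1.
  rewrite adjmx1 mulmx1; split=> [v v0|v].
    rewrite -/(form _ v) formD form1 -[adjmx _ *m _](mulmx1) -mulmxA mulmxA.
    rewrite mulmx1 -[X in form (_ *m X)]mul1mx mulmxA -form_mul form1.
    by rewrite ltr_wpDl ?sqn_ge0 ?sqn_gt0.
  rewrite -/(form _ v) formB form1 -[X in form (_ *m X)]mul1mx mulmxA -form_mul form1.
  by rewrite subr_ge0.
exists (fun=> False); split; first by move=> z _; exists 1; rewrite ltr01.
move=> lam hl _ _ M den; have ha := lowerHP_re_lt0 hl.
have cth := th_contr hbeta hth ha N.+1.
set T := th ('i / lam) 0; set B := mobius_den beta ('i / lam) 0 N.+1 (th ('i / lam) N.+1).
have Bu : B \in unitmx by apply: mobius_den_unit.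
have Tu : T - 1%:M \in unitmx by apply: th_sub1_unit.
(* The common right factor [B] drops out of the quotient; the upper block, which is the denominator,
   is invertible because [T - 1] and [B] are. *)
have ME : M *m col_mx (th ('i / lam) N.+1) 1%:M =
    col_mx (s *: (T - 1%:M) *m B) (s *: (T + 1%:M) *m B).
  rewrite /M scrW_prodT -mulmxA mobius_col //.
  have := th_mobius hbeta hth ha 0 N.+1; rewrite add0n => <-.
  by rewrite mulmxA Kmx_col scale_col_mx mul_col_mx.
have denE : den = s *: (T - 1%:M) *m B by rewrite /den submx_col ME col_mxKu.
have denu : den \in unitmx.
  by rewrite denE unitmx_mul Bu andbT unitmxZ ?unitfE.
split; first exact: denu.
rewrite (weyl_funE hl) submx_col ME col_mxKd; congr (_ *: _).
have -> : s *: (T + 1%:M) *m B = (T + 1%:M) *m invmx (T - 1%:M) *m den.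
  by rewrite denE mulmxA -scalemxAr mulmxKV // scalemxAl.
by rewrite mulmxK.
Qed.

Local Notation q a := (1 + `|a| ^+ 2).
Local Notation c a := (- (a + Num.conj a)).

Definition cayX (psi : 'M[C]_p) : 'M[C]_p := 1%:M + - 'i *: psi.
Definition cayY (psi : 'M[C]_p) : 'M[C]_p := - 'i *: psi - 1%:M.

(* With [s (X; Y) = K^* (1; - i psi)], psi lies in the N-th disc at lam iff
   [(X; Y)] is, up to a right factor, [PT (R; Q)]; [(th Y; Y)] is too, and the
   difference [(X - th Y; 0)] has a nonnegative j-form. *)
Lemma disc_point_bound N lam (psi Rm Qm : 'M[C]_p) (u : 'cV[C]_p) :
  lowerHP lam -> psd (adjmx Qm *m Qm - adjmx Rm *m Rm) ->
  let M := scrW beta N lam in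
  let den := ulsubmx M *m Rm + ursubmx M *m Qm in
  den \in unitmx ->
  psi = 'i *: ((dlsubmx M *m Rm + drsubmx M *m Qm) *m invmx den) ->
  c ('i / lam) * N.+1%:R * sqn ((cayX psi - th ('i / lam) 0 *m cayY psi) *m u) <=
  4%:R * q ('i / lam) * sqn (cayY psi *m u).
Proof.
move=> hl RQ M den denu psiE; have ha := lowerHP_re_lt0 hl.
set a := 'i / lam in ha *; set X := cayX psi; set Y := cayY psi.
(* The inverse of [den] normalises [(R; Q)], and [s^-1] undoes the scalar produced by [adjmx K]. *)
pose w := s^-1 *: (invmx den *m u).
have V1 : col_mx (X *m u) (Y *m u) = prodT beta a 0 N.+1 *m col_mx (Rm *m w) (Qm *m w).
  have -> : prodT beta a 0 N.+1 = adjmx K *m M by rewrite /M scrW_prodT mulmxA adj_mul_Kmx mul1mx.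
  rewrite -[in RHS]mul_col_mx [RHS]mulmxA -(mulmxA (adjmx K)).
  have -> : M *m col_mx Rm Qm = col_mx 1%:M (- 'i *: psi) *m den.
    rewrite mul_col_mx mul1mx psiE scalerA mulNr -expr2 sqrCi opprK scale1r mulmxKV //.
    by rewrite /den !submx_col vsubmxK.
  rewrite mulmxA adj_Kmx_col -/s -[1%:M + _]/X -[_ - 1%:M]/Y /w -!scalemxAr -!scalemxAl scalerA mulVf //.
  by rewrite scale1r -mulmxA mulKVmx // mul_col_mx.
clearbody X Y.
have cth := th_contr hbeta hth ha N.+1.
have V2 := mobius_colV hbeta ha 0 N.+1 (Y *m u) cth.
have := th_mobius hbeta hth ha 0 N.+1; rewrite add0n => thE; rewrite -thE in V2.
have jw : form j (col_mx (Rm *m w) (Qm *m w)) <= 0.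
  rewrite form_col subr_le0 -subr_ge0 -!form1 !form_mul !mulmx1 -formB.
  exact: RQ.
have D : col_mx (X *m u) (Y *m u) - col_mx (th a 0 *m (Y *m u)) (Y *m u) =
    col_mx ((X - th a 0 *m Y) *m u) 0.
  by rewrite opp_col_mx add_col_mx subrr mulmxBl mulmxA.
have := prodT_diam hbeta ha V1 V2 jw (contr_form _ cth).
rewrite D form_col sqn0 subr0 => /(_ (sqn_ge0 _)) /le_trans; apply.
rewrite -subr_ge0 !form_col.
move: (sqn_ge0 (X *m u)) (sqn_ge0 (th a 0 *m (Y *m u))).
move: (sqn (X *m u)) (sqn (th a 0 *m (Y *m u))) (sqn (Y *m u)) => s1 s2 t s10 s20.
have -> : 4%:R * q a * t - - (2%:R * q a * (s1 - t + (s2 - t))) = 2%:R * q a * (s1 + s2).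
  by move: (`|a| ^+ 2) => x; ring.
by rewrite mulr_ge0 ?addr_ge0 // mulr_ge0 ?ler0n // addr_ge0 ?exprn_ge0.
Qed.

Lemma discrete_punctured (S : C -> Prop) lam : discrete_in_lowerHP S -> lowerHP lam ->
  punctured (fun h => ~ S (lam + h)).
Proof.
move=> dS /dS[r [r0 rS]]; exists r%:C => [|h hr h0 /rS]; first by rewrite ltcR.
rewrite -subr_eq0 addrAC subrr add0r => /(_ h0).
by rewrite (lt_geF hr).
Qed.

Let pu_and := @punctured_and C.
Let pu_imp := @punctured_imp C.
Let pu_true := @punctured_true C.
Let pu_ex := @punctured_ex C.

Lemma tend0_flim (f : C -> C) z : tend0 (fun h => f (z + h) - f z) ->
  flim (@punctured C) (fun h => f (z + h)) (f z).
Proof. by move=> tf e /tf; apply: near0_punctured. Qed.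

(** [disc_point_bound] is available only off [S] and [D], which may contain [lam] itself. Both sets
    are discrete and both sides of the inequality are continuous, so it extends by a limit over
    punctured neighbourhoods. *)
Lemma disc_bound N psi (u : 'cV[C]_p) lam : weyl_disc beta N psi -> lowerHP lam ->
  c ('i / lam) * N.+1%:R *
    sqn ((cayX (psi lam) - th ('i / lam) 0 *m cayY (psi lam)) *m u) <=
  4%:R * q ('i / lam) * sqn (cayY (psi lam) *m u).
Proof.
move=> [hpsi [Rf [Qf [S [[dS _ _] _ _ RQ [D [dD DE]]]]]]] hl.
rewrite -subr_ge0; set a := 'i / lam; set X := cayX _; set Y := cayY _.
have LP : mxlim (@punctured C) (fun h => psi (lam + h)) (psi lam).
  move=> i k; apply: (@tend0_flim (fun w => psi w i k)).
  exact: holo_at_tend0 (hpsi _ hl) i k.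
have LT : mxlim (@punctured C) (fun h => th ('i / (lam + h)) 0) (th a 0).
  move=> i k; apply: (@tend0_flim (fun w => th ('i / w) 0 i k)).
  exact: cdiff_tend0 (th_mdiff 0 hl i k).
have La : flim (@punctured C) (fun h => 'i / (lam + h)) a.
  exact: (@tend0_flim (fun w => 'i / w)) (cdiff_tend0 (cdiff_inv_lower hl)).
have LiP : mxlim (@punctured C) (fun h => - 'i *: psi (lam + h)) (- 'i *: psi lam).
  by apply: mxlim_scale => //; apply: flim_cst.
have LX : mxlim (@punctured C) (fun h => 1%:M + - 'i *: psi (lam + h)) X.
  by apply: mxlim_add => //; apply: mxlim_cst.
have LY : mxlim (@punctured C) (fun h => - 'i *: psi (lam + h) - 1%:M) Y.
  by apply: mxlim_add => //; apply: mxlim_cst.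
have Lu : mxlim (@punctured C) (fun=> u) u by apply: mxlim_cst.
have Lsqn (v : C -> 'cV[C]_p) w : mxlim (@punctured C) v w ->
    flim (@punctured C) (fun h => sqn (v h)) (sqn w).
  move=> vw; rewrite -form1; apply: flim_eq (flim_form pu_and pu_imp pu_true 1%:M vw) => // h.
  by rewrite form1.
have Lq : flim (@punctured C) (fun h => 4%:R * q ('i / (lam + h))) (4%:R * q a).
  apply: flim_mul => //; first exact: flim_cst.
  apply: flim_add => //; first exact: flim_cst.
  rewrite normCK; apply: (flim_eq pu_imp (g := fun h =>
    ('i / (lam + h)) * Num.conj ('i / (lam + h)))) => [h|]; first by rewrite normCK.
  by apply: flim_mul => //; apply: flim_conj.
have Lc : flim (@punctured C) (fun h => c ('i / (lam + h)) * N.+1%:R) (c a * N.+1%:R).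
  apply: flim_mul => //; last exact: flim_cst.
  by apply: flim_opp => //; apply: flim_add => //; apply: flim_conj.
have L1 := flim_mul pu_and pu_imp Lq (Lsqn _ _ (mxlim_mul pu_and pu_imp pu_true LY Lu)).
have L2 := flim_mul pu_and pu_imp Lc (Lsqn _ _ (mxlim_mul pu_and pu_imp pu_true
  (mxlim_add pu_and pu_imp LX (mxlim_opp pu_imp (mxlim_mul pu_and pu_imp pu_true LT LY))) Lu)).
apply: (flim_ge0 pu_and pu_ex _ (flim_add pu_and pu_imp L1 (flim_opp pu_imp L2))).
have good := pu_and (near0_punctured (lowerHP_near hl))
  (pu_and (discrete_punctured dS hl) (discrete_punctured dD hl)).
apply: punctured_imp good => h [hh [Sh Dh]].
have [_ RQh] := RQ _ hh Sh; have [denu psiE] := DE _ hh Sh Dh.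
rewrite subr_ge0; exact: (disc_point_bound u hh RQh denu psiE).
Qed.

(** The right side of [disc_bound] does not depend on [N], so the growing factor on the left forces
    [X = th Y]. Solving this for [psi] inverts the Cayley transform. *)
Lemma weyl_fun_unique psi lam : (forall N, weyl_disc beta N psi) -> lowerHP lam ->
  psi lam = weyl_fun lam.
Proof.
move=> dpsi hl; have ha := lowerHP_re_lt0 hl; set a := 'i / lam in ha.
pose X := cayX (psi lam); pose Y := cayY (psi lam).
have XY : X - th a 0 *m Y = 0.
  have Z (u : 'cV[C]_p) : (X - th a 0 *m Y) *m u = 0.
    apply/eqP; rewrite -sqn_eq0; apply/negPn/negP => s0.
    have {}s0 : 0 < sqn ((X - th a 0 *m Y) *m u) by rewrite lt0r s0 sqn_ge0.
    have c0 : 0 < c a by rewrite oppr_gt0.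
    have B0 : 0 <= 4%:R * q a * sqn (Y *m u).
      by rewrite mulr_ge0 ?sqn_ge0 // mulr_ge0 ?ler0n // addr_ge0 ?exprn_ge0.
    (* The disc of index [n] supplies the factor [n + 1], which contradicts the bound with [n]. *)
    have [n nE] := archi_complex (mulr_gt0 c0 s0) (ger0_real B0).
    have := le_trans (disc_bound u (dpsi n) hl) nE.
    rewrite -/a -/X -/Y mulrAC ler_pM2l ?mulr_gt0 // ler_nat ltnn //.
  apply/matrixP => i k; have /matrixP/(_ i 0) := Z (delta_mx k 0).
  by rewrite -colE !mxE.
have Tu := th_sub1_unit hbeta hth ha 0.
rewrite weyl_funE // -/a; move: XY Tu; rewrite {}/X {}/Y /cayX /cayY.
move: (th a 0) => T E Tu.
(* With [y = - i psi], the equation [1 + y = T (y - 1)] rearranges to [(T - 1) y = T + 1]. *)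
have E2 : (T - 1%:M) *m (- 'i *: psi lam) = T + 1%:M.
  move: (- 'i *: psi lam) E => y E.
  apply/eqP; rewrite -subr_eq0 -oppr_eq0 -[X in _ == X]E; apply/eqP.
  rewrite mulmxBl mulmxBr mul1mx mulmx1; move: (T *m y) => x.
  by apply/matrixP => i k; rewrite !mxE; ring.
have -> : psi lam = 'i *: (- 'i *: psi lam).
  by rewrite scalerA mulrN -expr2 sqrCi opprK scale1r.
congr (_ *: _); rewrite -[LHS](mulKmx Tu) E2.
(* Solving puts the inverse on the left, while [weyl_fun] has it on the right; the two agree because
   polynomials in [T] commute. *)
have comm : (T - 1%:M) *m (T + 1%:M) = (T + 1%:M) *m (T - 1%:M).
  rewrite mulmxBl mul1mx mulmxDr mulmx1 mulmxDl mul1mx mulmxBr mulmx1.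
  by move: (T *m T) => x; apply/matrixP => i k; rewrite !mxE; ring.
by rewrite -[X in invmx _ *m X](mulmxK Tu) -comm -mulmxA mulKmx.
Qed.
End WeylDisc.

Theorem theorem6p4 (R : realType) (p : nat) (hp : (0 < p)%N)
    (beta : nat -> 'M[R[i]]_(p, p + p))
    (hbeta : forall k, beta k *m Jmx R p *m adjmx (beta k) = 1%:M) :
  exists phi_inf : R[i] -> 'M[R[i]]_p,
    (forall N, weyl_disc beta N phi_inf) /\
    (forall psi : R[i] -> 'M[R[i]]_p, (forall N, weyl_disc beta N psi) ->
       forall lam, lowerHP lam -> psi lam = phi_inf lam).
Proof.
have [th hth] := weyl_limit hbeta.
exists (weyl_fun th); split=> [N|psi dpsi lam hl].
  exact: weyl_fun_disc.
exact: weyl_fun_unique.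
Qed.
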